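(* Under the standing model and assumptions below, if $E(\Vert\varepsilon\Vert^2)<\infty$, then any estimator $\hat W_n\in\arg\min_{W\in\Theta_s}U_n(W)$ satisfies $\hat W_n\to W^0$ in probability as $n\to\infty$ (in the quotient parameter space).
   Context: Let $(Y_t,Z_t)_{t\in\mathbb N}$ be i.i.d. random vectors in $\mathbb R^d\times\mathbb R^{d'}$, each with the law of a generic pair $(Y,Z)$. The model is $Y_t=F_{W^0}(Z_t)+\varepsilon_t$, where for a weight vector $W$, $F_W:\mathbb R^{d'}\to\mathbb R^d$ is the function computed by a one-hidden-layer multilayer perceptron with weights $W$ and sigmoidal activation functions in the hidden units, and $W^0$ is the true weight vector. The noise $(\varepsilon_t)$ is i.i.d., centered, independent of the inputs $(Z_t)$, with invertible covariance matrix; $\varepsilon$ denotes a generic variable with the law of $\varepsilon_t$. The parameter set $\Theta_s\subset\mathbb R^s$ is compact, and contains $W^0$. Parameters are considered modulo the finite group of weight transformations leaving $F_W$ invariant, and the model is assumed identifiable in this quotient space: $F_W=F_{W^0}$ almost surely on the support of $Z$ implies $W=W^0$ (e.g. the number of hidden units is the true one). Define \[ \Gamma_n(W)=\frac1n\sum_{t=1}^n (Y_t-F_W(Z_t))(Y_t-F_W(Z_t))^T,\qquad U_n(W)=\ln\det\Gamma_n(W), \] and $\Gamma(W)=E\big[(Y-F_W(Z))(Y-F_W(Z))^T\big]$, so $\Gamma(W^0)$ is the (invertible) noise covariance. *)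

(* Defs.v *)
From HB Require Import structures.
From mathcomp Require Import all_boot all_order all_algebra.
From mathcomp Require Import all_classical all_reals all_analysis.

Set Implicit Arguments.
Unset Strict Implicit.
Unset Printing Implicit Defensive.

Import Order.TTheory GRing.Theory Num.Theory.
Import numFieldNormedType.Exports.

Local Open Scope classical_set_scope.
Local Open Scope ring_scope.

Definition sigmoidal {R : realType} (phi : R -> R) : Prop :=
  continuous phi /\ {homo phi : x y / x <= y} /\
  exists lm lp : R, lm < lp /\ phi @ -oo --> lm /\ phi @ +oo --> lp.

(* Weights of a one-hidden-layer MLP with d' inputs, H hidden units and d    *)
(* outputs: ((A, a), (B, b)) with A : H x d' input weights, a : hidden       *)
(* biases, B : d x H output weights, b : output biases.  This is R^s with    *)
(* s = H (d'+1) + d (H+1), equipped with its (product/max) norm.             *)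
Definition mlp_param (R : realType) (d' H d : nat) : Type :=
  ('M[R]_(H, d') * 'cV[R]_H) * ('M[R]_(d, H) * 'cV[R]_d).

Definition mlp {R : realType} {d' H d : nat} (phi : R -> R)
    (W : mlp_param R d' H d) (z : 'cV[R]_d') : 'cV[R]_d :=
  W.2.1 *m map_mx phi (W.1.1 *m z + W.1.2) + W.2.2.

Section Proba.
Context {R : realType} {dT : measure_display} {T : measurableType dT}.
Variable P : probability T R.

Definition rect_event (k : nat) (X : T -> 'cV[R]_k) (B : 'I_k -> set R)
  : set T := [set w | forall i, B i (X w i ord0)].

Definition rv_measurable (k : nat) (X : T -> 'cV[R]_k) : Prop :=
  forall i, measurable_fun setT (fun w => X w i ord0).

(* Mutual independence of a sequence of random vectors (product rule on     *)
(* every finite family of measurable rectangles; rectangles form a           *)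
(* pi-system generating the Borel sigma-algebra of R^k).                     *)
Definition mutually_independent (k : nat) (X : nat -> T -> 'cV[R]_k) : Prop :=
  forall (J : seq nat) (B : nat -> 'I_k -> set R),
    uniq J -> (forall j i, measurable (B j i)) ->
    P [set w | forall j, j \in J -> rect_event (X j) (B j) w]
    = (\prod_(j <- J) P (rect_event (X j) (B j)))%E.

Definition identically_distributed (k : nat) (X : nat -> T -> 'cV[R]_k)
  : Prop :=
  forall t (B : 'I_k -> set R), (forall i, measurable (B i)) ->
    P (rect_event (X t) B) = P (rect_event (X 0%N) B).

Definition iid (k : nat) (X : nat -> T -> 'cV[R]_k) : Prop :=
  (forall t, rv_measurable (X t)) /\
  mutually_independent X /\ identically_distributed X.

Definition independent2 (k l : nat) (X : T -> 'cV[R]_k) (Y : T -> 'cV[R]_l)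
  : Prop :=
  forall (A : 'I_k -> set R) (B : 'I_l -> set R),
    (forall i, measurable (A i)) -> (forall i, measurable (B i)) ->
    P (rect_event X A `&` rect_event Y B)
    = (P (rect_event X A) * P (rect_event Y B))%E.

(* Covariance matrix E[X X^T] (for a centered, square integrable X).        *)
Definition second_moment_mx (k : nat) (X : T -> 'cV[R]_k) : 'M[R]_k :=
  \matrix_(i, j) fine (\int[P]_w (X w i ord0 * X w j ord0)%:E).

End Proba.

Definition Gamma_n {R : realType} {T : Type} {d' H d : nat} (phi : R -> R)
    (Y : nat -> T -> 'cV[R]_d) (Z : nat -> T -> 'cV[R]_d')
    (n : nat) (W : mlp_param R d' H d) (w : T) : 'M[R]_d :=
  n%:R^-1 *: \sum_(t < n)
     ((Y t w - mlp phi W (Z t w)) *m (Y t w - mlp phi W (Z t w))^T).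

(* U_n(W) = ln det Gamma_n(W), with the convention ln 0 = -oo               *)
(* (det Gamma_n(W) >= 0 always, Gamma_n being positive semi-definite).      *)
Definition U_n {R : realType} {T : Type} {d' H d : nat} (phi : R -> R)
    (Y : nat -> T -> 'cV[R]_d) (Z : nat -> T -> 'cV[R]_d')
    (n : nat) (W : mlp_param R d' H d) (w : T) : \bar R :=
  let D := \det (Gamma_n phi Y Z n W w) in
  if 0 < D then (ln D)%:E else -oo%E.

Definition param_measurable {R : realType} {dT : measure_display}
    {T : measurableType dT} {d' H d : nat} (f : T -> mlp_param R d' H d)
  : Prop :=
  (forall i j, measurable_fun setT (fun w => (f w).1.1 i j)) /\
  (forall i j, measurable_fun setT (fun w => (f w).1.2 i j)) /\
  (forall i j, measurable_fun setT (fun w => (f w).2.1 i j)) /\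
  (forall i j, measurable_fun setT (fun w => (f w).2.2 i j)).

(* Main.v *)
(* Writing F_W for the perceptron and eps = Y - F_{W0}(Z), independence of eps
   and Z gives Gamma(W) = Sigma + E[D D^T] with D = F_{W0}(Z) - F_W(Z).  A
   nonzero positive semidefinite perturbation strictly increases the determinant
   of a positive definite matrix, so by identifiability det Gamma exceeds
   det Sigma off the orbit of W0.  Locally uniformly in W, Gamma_n(W) is close to
   Gamma(W) with high probability: the variation of the residuals over a small
   ball of weights has a measurable majorant with small mean, and the weak law
   of large numbers applies to that majorant and to the residual products.
   Compactness of Theta then excludes minimizers far from the orbit.

   The weak law only needs pairwise independence and a first moment (truncation
   and Chebyshev). *)

Require Import Defs.
From HB Require Import structures.
From mathcomp Require Import all_boot all_order all_algebra.
From mathcomp Require Import all_classical all_reals all_analysis.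
From mathcomp Require Import measurable_realfun.
From mathcomp Require Import ring lra.

Set Implicit Arguments.
Unset Strict Implicit.
Unset Printing Implicit Defensive.

Import Order.TTheory GRing.Theory Num.Theory.
Import numFieldNormedType.Exports.

Local Open Scope classical_set_scope.
Local Open Scope ring_scope.

(** * Independence and expectations of products *)

Section IndependentVariables.
Context {R : realType} {dT : measure_display} {T : measurableType dT}.
Variable P : probability T R.

(** A finite second moment of the noise makes the products of residuals integrable but guarantees
    them no variance, hence the truncation. The activation is not assumed Lipschitz and the inputs
    have no moments, so the variation over a ball of weights is not controlled linearly in the
    radius: it tends to 0 for each fixed input by continuity, stays bounded because the activation
    is, and its mean is made small by dominated convergence.

    Candidates are compared through det Gamma_n, since U_n may take the value -oo. Around W1 off the
    orbit, the midpoint of det Sigma and det Gamma(W1) lies, with high probability, below det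
    Gamma_n(W) for all W near W1 and above det Gamma_n(W0), so W0 beats all these W at once.

    Independence is assumed on coordinate rectangles only, whereas residuals are nonlinear functions
    of whole vectors; a pi-system argument extends it to the generated sigma-algebra. Events
    quantified over a ball of weights are only controlled up to measurable exceptional sets;
    measurability of the final event rests on the finiteness of the group. *)

Definition independent_events_of {d1 d2 : measure_display}
    {T1 : measurableType d1} {T2 : measurableType d2}
    (U : T -> T1) (V : T -> T2) : Prop :=
  forall A B, measurable A -> measurable B ->
    P (U @^-1` A `&` V @^-1` B) = (P (U @^-1` A) * P (V @^-1` B))%E.

Lemma independent_events_of_comp (d1 d2 d3 d4 : measure_display)
    (T1 : measurableType d1) (T2 : measurableType d2)
    (T3 : measurableType d3) (T4 : measurableType d4)
    (U : T -> T1) (V : T -> T2) (f : T1 -> T3) (g : T2 -> T4) :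
  measurable_fun setT f -> measurable_fun setT g ->
  independent_events_of U V -> independent_events_of (f \o U) (g \o V).
Proof.
move=> mf mg UV A B mA mB.
have mfA : measurable (f @^-1` A) by rewrite -[f @^-1` _]setTI; exact: mf.
have mgB : measurable (g @^-1` B) by rewrite -[g @^-1` _]setTI; exact: mg.
exact: (UV _ _ mfA mgB).
Qed.

(** Independence says that the law of the pair and the product of the marginal laws agree on
    rectangles, hence everywhere by uniqueness of the product measure; Fubini then separates the
    factors. *)
Lemma Rintegral_independentM (U V : T -> R) :
  measurable_fun setT U -> measurable_fun setT V ->
  independent_events_of U V ->
  P.-integrable setT (EFin \o U) -> P.-integrable setT (EFin \o V) ->
  P.-integrable setT (EFin \o (fun w => U w * V w)) ->
  \int[P]_w (U w * V w) = \int[P]_w U w * \int[P]_w V w.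
Proof.
move=> mU mV UV iU iV iUV.
pose fU : {mfun T >-> R} := HB.pack U (isMeasurableFun.Build _ _ _ _ _ mU).
pose fV : {mfun T >-> R} := HB.pack V (isMeasurableFun.Build _ _ _ _ _ mV).
have mUV : measurable_fun setT (fun w => (U w, V w)).
  exact: measurable_fun_pair.
pose fUV : {mfun T >-> (R * R)%type} :=
  HB.pack (fun w => (U w, V w)) (isMeasurableFun.Build _ _ _ _ _ mUV).
pose m1 := distribution P fU; pose m2 := distribution P fV.
pose m := distribution P fUV.
pose f (z : R * R) : \bar R := (z.1 * z.2)%:E.
have mf : measurable_fun setT f.
  apply/measurable_EFinP; apply: measurable_funM.
    exact: measurable_fst.
  exact: measurable_snd.
have mE A : measurable A -> (m1 \x m2)%E A = m A.
  apply: product_measure_unique => B C mB mC.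
  exact: UV.
have imf : m.-integrable setT f.
  by apply: (@integrable_pushforward _ _ _ _ _ _ mUV P setT f mf).
have i12f : (m1 \x m2)%E.-integrable setT f.
  move/integrableP: imf => [_ lf]; apply/integrableP; split => //.
  by rewrite (eq_measure_integral m) // => A mA _; exact: mE.
have mid : measurable_fun [set: R] (EFin : R -> \bar R).
  exact/measurable_EFinP.
have im2 : m2.-integrable setT (EFin : R -> \bar R).
  by apply: (@integrable_pushforward _ _ _ _ _ _ mV P setT _ mid).
have im1 : m1.-integrable setT (EFin : R -> \bar R).
  by apply: (@integrable_pushforward _ _ _ _ _ _ mU P setT _ mid).
have e2 : (\int[m2]_y y%:E)%E = (\int[P]_w (V w)%:E)%E.
  by rewrite (@integral_pushforward _ _ _ _ _ _ mV P setT _ mid).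
have e1 : (\int[m1]_y y%:E)%E = (\int[P]_w (U w)%:E)%E.
  by rewrite (@integral_pushforward _ _ _ _ _ _ mU P setT _ mid).
have V_fin := integrable_fin_num measurableT iV.
have em : (\int[m]_z f z)%E = (\int[P]_w (U w * V w)%:E)%E.
  by rewrite (@integral_pushforward _ _ _ _ _ _ mUV P setT _ mf).
have := integral12_prod_meas1 i12f.
rewrite (eq_measure_integral m) ?em; last by move=> A mA _; exact: mE.
rewrite /Rintegral => <-.
have -> : fubini_F m2 f = (fun x => x%:E * (\int[P]_w V w)%:E)%E.
  apply/funext => x; rewrite /fubini_F /f /=.
  under eq_integral do rewrite EFinM.
  by rewrite integralZl// e2 /Rintegral fineK.
rewrite integralZr// e1 fineM ?fineK//.
exact: (integrable_fin_num measurableT iU).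
Qed.

End IndependentVariables.

(** * Real-valued integrals under a probability, and Markov's inequality *)

Section RintegralComplements.
Context {R : realType} {dT : measure_display} {T : measurableType dT}.
Variable P : probability T R.

Lemma le_bounded_integrable (g : T -> R) (C : R) : measurable_fun setT g ->
  (forall w, `|g w| <= C) -> P.-integrable setT (EFin \o g).
Proof.
move=> mg gC; apply: measurable_bounded_integrable => //.
  by apply: le_lt_trans (probability_le1 P measurableT) _; rewrite ltry.
exists C; split; first exact: num_real.
by move=> M CM w _; apply: le_trans (gC w) (ltW CM).
Qed.

Lemma le_integrableR (f g : T -> R) : measurable_fun setT f ->
  (forall w, `|f w| <= g w) -> P.-integrable setT (EFin \o g) ->
  P.-integrable setT (EFin \o f).
Proof.
move=> mf fg; apply: le_integrable => //; first exact/measurable_EFinP.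
move=> w _ /=; rewrite lee_fin; apply: le_trans (fg w) _; exact: ler_norm.
Qed.

Lemma integrable_normR (g : T -> R) : P.-integrable setT (EFin \o g) ->
  P.-integrable setT (EFin \o (fun w => `|g w|)).
Proof. exact: integrable_norm. Qed.

Lemma integrableZR (c : R) (g : T -> R) : P.-integrable setT (EFin \o g) ->
  P.-integrable setT (EFin \o (fun w => c * g w)).
Proof.
move=> ig; have := @integrableZl _ _ _ P setT measurableT c _ ig.
by apply: eq_integrable => // w _.
Qed.

Lemma integrableDR (f g : T -> R) : P.-integrable setT (EFin \o f) ->
  P.-integrable setT (EFin \o g) ->
  P.-integrable setT (EFin \o (fun w => f w + g w)).
Proof.
move=> fi gi; have := integrableD measurableT fi gi.
by apply: eq_integrable => // w _.
Qed.

Lemma measurable_fun_integrableR (g : T -> R) :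
  P.-integrable setT (EFin \o g) -> measurable_fun setT g.
Proof. by move=> /measurable_int /measurable_EFinP. Qed.

Lemma integrable_cstR (c : R) : P.-integrable setT (EFin \o (fun=> c)).
Proof. exact: finite_measure_integrable_cst. Qed.

Lemma Rintegral_cst_probability (c : R) : \int[P]__ c = c.
Proof.
rewrite Rintegral_cst// [fine _](_ : _ = 1) ?mulr1//.
exact: (congr1 fine (@probability_setT _ _ _ P)).
Qed.

Lemma integrable_sumR (I : Type) (r : seq I) (f : I -> T -> R) :
  (forall i, P.-integrable setT (EFin \o f i)) ->
  P.-integrable setT (EFin \o (fun w => \sum_(i <- r) f i w)).
Proof.
move=> fi; elim: r => [|i r IH].
  by under eq_fun do rewrite big_nil; exact: integrable_cstR.
by under eq_fun do rewrite big_cons; exact: integrableDR.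
Qed.

Lemma Rintegral_sum (I : Type) (r : seq I) (f : I -> T -> R) :
  (forall i, P.-integrable setT (EFin \o f i)) ->
  \int[P]_w (\sum_(i <- r) f i w) = \sum_(i <- r) \int[P]_w f i w.
Proof.
move=> fi; elim: r => [|i r IH].
  by rewrite big_nil; under eq_Rintegral do rewrite big_nil;
    rewrite Rintegral_cst// mul0r.
rewrite big_cons -IH -RintegralD//; last exact: integrable_sumR.
by apply: eq_Rintegral => w _; rewrite big_cons.
Qed.

Lemma markov_Rintegral (g : T -> R) (k : R) : 0 < k ->
  P.-integrable setT (EFin \o g) ->
  (P [set w | (k <= `|g w|)%R] <= (k^-1 * \int[P]_w `|g w|)%:E)%E.
Proof.
move=> k0 ig; have mg := measurable_fun_integrableR ig.
pose fg : {mfun T >-> R} := HB.pack g (isMeasurableFun.Build _ _ _ _ _ mg).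
have := @markov _ _ _ P fg id k k0 (@measurable_id _ _ _) (fun r h => h)
  (fun x y _ _ h => h).
have -> : [set x | (k%:E <= `|(fg x)%:E|)%E] = [set w | k <= `|g w|].
  by apply/seteqP; split => w /=; rewrite lee_fin.
rewrite unlock /= => h.
have e : (\int[P]_w (`|g w|)%:E)%E = (\int[P]_w `|g w|)%:E.
  by rewrite /Rintegral fineK//; apply: integrable_fin_num => //;
    exact: integrable_normR.
rewrite EFinM lee_pdivlMl//.
by move: h; rewrite -e.
Qed.

Lemma measurable_ge_norm (g : T -> R) (k : R) : measurable_fun setT g ->
  measurable [set w | k <= `|g w|].
Proof.
move=> mg; rewrite -[X in measurable X]setTI.
have mn : measurable_fun setT (fun w => `|g w|).
  exact: measurableT_comp.
have := mn measurableT `[k, +oo[%classic (measurable_itv _).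
congr (measurable _); congr (_ `&` _).
by apply/seteqP; split => w /=; rewrite in_itv/= andbT.
Qed.

End RintegralComplements.

(** * Properties holding with probability tending to one *)

Section WithHighProbability.
Context {R : realType} {dT : measure_display} {T : measurableType dT}.
Variable P : probability T R.

(* The exceptional event is only required to be contained in a measurable one,
   so that no measurability has to be checked for [Q] itself. *)
Definition whp (Q : nat -> T -> Prop) : Prop :=
  forall eta : R, 0 < eta -> \forall n \near \oo,
    exists2 B : set T, measurable B /\ (P B <= eta%:E)%E &
      forall w, ~ B w -> Q n w.

Lemma whpT (Q : nat -> T -> Prop) : (forall n w, Q n w) -> whp Q.
Proof.
move=> QT eta eta0; near=> n; exists set0 => //.
by split; [exact: measurable0 | rewrite measure0 lee_fin ltW].
Unshelve. all: by end_near. Qed.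

Lemma whp_mono (Q1 Q2 : nat -> T -> Prop) :
  (forall n w, (0 < n)%N -> Q1 n w -> Q2 n w) -> whp Q1 -> whp Q2.
Proof.
move=> Q12 h eta eta0; near=> n.
have n0 : (0 < n)%N by near: n; exact: nbhs_infty_gt.
have [B mB BQ] : exists2 B : set T, measurable B /\ (P B <= eta%:E)%E &
  forall w, ~ B w -> Q1 n w by near: n; exact: h.
by exists B => // w /BQ; exact: Q12.
Unshelve. all: by end_near. Qed.

Lemma whp_and (Q1 Q2 : nat -> T -> Prop) :
  whp Q1 -> whp Q2 -> whp (fun n w => Q1 n w /\ Q2 n w).
Proof.
move=> h1 h2 eta eta0.
have e2 : 0 < eta / 2 by rewrite divr_gt0.
near=> n.
have [B1 [mB1 PB1] Q1B] : exists2 B : set T,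
  measurable B /\ (P B <= (eta / 2)%:E)%E & forall w, ~ B w -> Q1 n w.
  by near: n; exact: h1.
have [B2 [mB2 PB2] Q2B] : exists2 B : set T,
  measurable B /\ (P B <= (eta / 2)%:E)%E & forall w, ~ B w -> Q2 n w.
  by near: n; exact: h2.
exists (B1 `|` B2).
  split; first exact: measurableU.
  rewrite (le_trans (measureU2 _ mB1 mB2))//.
  by rewrite [X in X%:E](splitr eta) EFinD leeD.
by move=> w /not_orP[/Q1B ? /Q2B].
Unshelve. all: by end_near. Qed.

Lemma whp_all_seq (I : eqType) (r : seq I) (Q : I -> nat -> T -> Prop) :
  (forall i, whp (Q i)) -> whp (fun n w => forall i, i \in r -> Q i n w).
Proof.
move=> h; elim: r => [|i r IH]; first exact: whpT.
apply: whp_mono (whp_and (h i) IH) => n w _ [Qi Qr] j.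
by rewrite in_cons => /predU1P[->|/Qr].
Qed.

Lemma whp_all (I : finType) (Q : I -> nat -> T -> Prop) :
  (forall i, whp (Q i)) -> whp (fun n w => forall i, Q i n w).
Proof.
move=> /(whp_all_seq (enum I)); apply: whp_mono => n w _ h i.
by apply: h; rewrite mem_enum.
Qed.

(** The way back from [whp] to convergence in probability. Measurability of [A n] is what allows its
    probability to be compared with that of the exceptional set containing it. *)
Lemma whp_cvg0 (A : nat -> set T) : (forall n, measurable (A n)) ->
  whp (fun n w => ~ A n w) -> P (A n) @[n --> \oo] --> 0%E.
Proof.
move=> mA h; apply/fine_cvgP; split.
  by near=> n; exact: fin_num_measure.
apply/cvgrPdist_le => e e0; near=> n.
have [B [mB PB] BA] : exists2 B : set T, measurable B /\ (P B <= e%:E)%E &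
  forall w, ~ B w -> ~ A n w by near: n; exact: h.
rewrite sub0r normrN ger0_norm; last by rewrite fine_ge0.
rewrite -lee_fin fineK ?fin_num_measure//.
apply: le_trans PB; apply: le_measure; rewrite ?inE// => w Aw.
by apply: contrapT => /BA.
Unshelve. all: by end_near. Qed.

End WithHighProbability.

(** * The weak law of large numbers *)

Section WeakLawOfLargeNumbers.
Context {R : realType} {dT : measure_display} {T : measurableType dT}.
Variable P : probability T R.

(** Both expectations are integrals of [f] against one and the same image measure on the line. This
    transports what is known at index 0 to every index of the sequence. *)
Lemma same_law_integrable (u v : T -> R) (f : R -> R) :
  measurable_fun setT u -> measurable_fun setT v -> measurable_fun setT f ->
  (forall A, measurable A -> P (u @^-1` A) = P (v @^-1` A)) ->
  P.-integrable setT (EFin \o (f \o v)) ->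
  P.-integrable setT (EFin \o (f \o u)) /\
  \int[P]_w f (u w) = \int[P]_w f (v w).
Proof.
move=> mu mv mf uv ifv.
pose fu : {mfun T >-> R} := HB.pack u (isMeasurableFun.Build _ _ _ _ _ mu).
pose fv : {mfun T >-> R} := HB.pack v (isMeasurableFun.Build _ _ _ _ _ mv).
pose mU := distribution P fu; pose mV := distribution P fv.
have mEf : measurable_fun [set: R] (EFin \o f) by exact/measurable_EFinP.
have e A : measurable A -> mU A = mV A by exact: uv.
have iV : mV.-integrable setT (EFin \o f).
  exact: (@integrable_pushforward _ _ _ _ _ _ mv P setT _ mEf).
have ifu : P.-integrable setT (EFin \o (f \o u)).
  apply/integrableP; split.
    by apply/measurable_EFinP; exact: measurableT_comp.
  move/integrableP: iV => [_].
  rewrite -(@eq_measure_integral _ _ _ _ mV mU); last by move=> A mA _; exact: e.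
  rewrite (@ge0_integral_pushforward _ _ _ _ _ _ mu P setT)//.
  exact: measurableT_comp.
split => //; rewrite /Rintegral; congr fine.
have := @integral_pushforward _ _ _ _ _ _ mu P setT _ mEf ifu measurableT.
have := @integral_pushforward _ _ _ _ _ _ mv P setT _ mEf ifv measurableT.
rewrite preimage_setT /= => <- <-.
by apply: eq_measure_integral => A mA _; exact: e.
Qed.

(** Orthogonality removes the off-diagonal terms of the expanded square, leaving [n] terms bounded
    by [C ^+ 2] instead of [n ^ 2]. *)
Lemma Rintegral_sqr_sum_le (c : nat -> T -> R) (C : R) (n : nat) :
  (forall t, measurable_fun setT (c t)) -> (forall t w, `|c t w| <= C) ->
  (forall s t, s != t -> \int[P]_w (c s w * c t w) = 0) ->
  \int[P]_w (\sum_(t < n) c t w) ^+ 2 <= n%:R * C ^+ 2.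
Proof.
move=> mc cC c0.
have C0 : 0 <= C by have := cC 0%N point; apply: le_trans.
have icc s t : P.-integrable setT (EFin \o (fun w => c s w * c t w)).
  apply: (@le_bounded_integrable _ _ _ _ _ (C * C)).
    exact: measurable_funM.
  by move=> w; rewrite normrM ler_pM.
have sqr_sumE m w : (\sum_(t < m) c t w) ^+ 2 =
    \sum_(s < m) \sum_(t < m) c s w * c t w.
  by rewrite expr2 big_distrlr.
under eq_Rintegral do rewrite sqr_sumE.
rewrite Rintegral_sum; last by move=> s; exact: integrable_sumR.
rewrite mulr_natl -[X in _ *+ X](card_ord n) -sumr_const.
apply: ler_sum => s _; rewrite Rintegral_sum// (bigD1 s)//= big1 ?addr0; last first.
  by move=> t ts; rewrite c0// eq_sym.
have -> : C ^+ 2 = \int[P]_w (C ^+ 2).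
  by rewrite Rintegral_cst_probability.
apply: le_Rintegral => //; first exact: integrable_cstR.
move=> w _; rewrite -expr2 -[leLHS]ger0_norm ?sqr_ge0// normrX.
by rewrite lerXn2r// nnegrE.
Qed.

(** Large values are sent to 0 rather than clipped, so the remainder [x - truncate K x] is either 0
    or [x]. *)
Definition truncate (K : R) (x : R) : R := if `|x| <= K then x else 0.

Lemma measurable_truncate (K : R) : measurable_fun setT (truncate K).
Proof.
apply: measurable_fun_ifT => //.
by apply: measurable_fun_ler => //; exact: measurableT_comp.
Qed.

Lemma truncate_le (K x : R) : 0 <= K -> `|truncate K x| <= K.
Proof. by move=> K0; rewrite /truncate; case: ifP => // _; rewrite normr0. Qed.

Lemma truncate_le_norm (K x : R) : `|x - truncate K x| <= `|x|.
Proof.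
by rewrite /truncate; case: ifP => _; rewrite ?subrr ?normr0 ?subr0.
Qed.

(** Dominated convergence along integer levels: at each point the truncation eventually equals [u],
    and the remainder never exceeds [u] in absolute value. *)
Lemma truncate_L1 (u : T -> R) (e : R) : 0 < e ->
  P.-integrable setT (EFin \o u) ->
  exists2 K : R, 0 <= K & \int[P]_w `|u w - truncate K (u w)| <= e.
Proof.
move=> e0 iu; have mu := measurable_fun_integrableR iu.
have mt n : measurable_fun setT (fun w => truncate n%:R (u w)).
  by apply: measurableT_comp => //; exact: measurable_truncate.
have mtE n : measurable_fun setT (fun w => (truncate n%:R (u w))%:E).
  exact/measurable_EFinP.
have muE : measurable_fun setT (EFin \o u) by exact/measurable_EFinP.
have cvg : {ae P, forall w, [set: T] w ->
    (truncate n%:R (u w))%:E @[n --> \oo] --> (EFin \o u) w}.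
  apply: aeW => w _; apply: cvg_near_cst; near=> n.
  rewrite /truncate ifT//; near: n.
  exact: nbhs_infty_ger.
have dom : {ae P, forall w n, [set: T] w ->
    (`|(truncate n%:R (u w))%:E| <= `|u w|%:E)%E}.
  apply: aeW => w n _ /=; rewrite lee_fin /truncate.
  by case: ifP => // _; rewrite normr0.
have [_ h _] := dominated_convergence measurableT mtE muE cvg
  (integrable_normR iu) dom.
move/fine_cvgP: h => [_ /cvgrPdist_le/(_ e e0)] [N _ /(_ N (leqnn N))] /=.
rewrite sub0r normrN => h; exists N%:R => //.
apply: le_trans h; apply: le_trans (ler_norm _); rewrite /Rintegral le_eqVlt.
apply/orP; left; apply/eqP; congr fine; apply: eq_integral => w _ /=.
by rewrite -distrC.
Unshelve. all: by end_near. Qed.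

(** The deviation splits into three parts, each given [k / 3]: the average of the remainders [r],
    small in L1 uniformly in the index (Markov); the average of the centered truncations [g],
    bounded and pairwise orthogonal (Chebyshev); and the bias [mK - m] of the truncated mean. *)
Theorem weak_law_of_large_numbers (u : nat -> T -> R) (k : R) :
  (forall t, measurable_fun setT (u t)) ->
  (forall s t, s != t -> independent_events_of P (u s) (u t)) ->
  (forall t A, measurable A -> P (u t @^-1` A) = P (u 0%N @^-1` A)) ->
  P.-integrable setT (EFin \o u 0%N) -> 0 < k ->
  whp P (fun n w =>
    `|n%:R^-1 * \sum_(t < n) u t w - \int[P]_w u 0%N w| < k).
Proof.
move=> mu indep law iu k0 eta eta0.
(* The first bound makes Markov's inequality at level [k / 3] cost at most [eta / 2]; the second
   keeps the truncation bias below [k / 3]. *)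
pose e := Num.min (k * eta / 6) (k / 3).
have e0 : 0 < e by rewrite lt_min !divr_gt0 ?mulr_gt0.
have [K K0 eK] := truncate_L1 e0 iu.
set m := \int[P]_w u 0%N w.
pose mK := \int[P]_w truncate K (u 0%N w).
pose r x : R := x - truncate K x.
pose g x : R := truncate K x - mK.
have mtr := measurable_truncate K.
have mr : measurable_fun setT r by exact: measurable_funB.
have mg : measurable_fun setT g by exact: measurable_funB.
have ir0 : P.-integrable setT (EFin \o (r \o u 0%N)).
  apply: le_integrableR (integrable_normR iu); first exact: measurableT_comp.
  by move=> w; exact: truncate_le_norm.
have itr : P.-integrable setT (EFin \o (truncate K \o u 0%N)).
  apply: (@le_bounded_integrable _ _ _ _ _ K); first exact: measurableT_comp.
  by move=> w; exact: truncate_le.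
have mKm : `|mK - m| <= e.
  rewrite distrC -RintegralB//; apply: le_trans eK.
  by apply: le_normr_Rintegral.
have gC x : `|g x| <= K + `|mK|.
  by rewrite (le_trans (ler_normB _ _))// lerD2r truncate_le.
have ig t : P.-integrable setT (EFin \o (g \o u t)).
  apply: (@le_bounded_integrable _ _ _ _ _ (K + `|mK|)) => [|w].
    exact: measurableT_comp.
  exact: gC.
have ir t := same_law_integrable (mu t) (mu 0%N) mr (law t) ir0.
have irn t : P.-integrable setT (EFin \o (fun w => `|r (u t w)|)).
  by apply: integrable_normR; case: (ir t).
have irt t : \int[P]_w `|r (u t w)| <= e.
  rewrite (same_law_integrable (mu t) (mu 0%N) (f := fun x => `|r x|)
    _ (law t) _).2//.
    by apply: measurableT_comp.
  exact: integrable_normR.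
have Eg t : \int[P]_w g (u t w) = 0.
  rewrite (same_law_integrable (mu t) (mu 0%N) mg (law t) (ig 0%N)).2.
  rewrite /g RintegralB//; last exact: integrable_cstR.
  by rewrite Rintegral_cst_probability subrr.
have Egg s t : s != t -> \int[P]_w (g (u s w) * g (u t w)) = 0.
  move=> st; rewrite (@Rintegral_independentM _ _ _ P (g \o u s) (g \o u t)).
  - by rewrite /= !Eg mulr0.
  - exact: measurableT_comp.
  - exact: measurableT_comp.
  - exact: independent_events_of_comp (indep _ _ st).
  - exact: ig.
  - exact: ig.
  - apply: (@le_bounded_integrable _ _ _ _ _ ((K + `|mK|) * (K + `|mK|))).
      by apply: measurable_funM; exact: measurableT_comp.
    by move=> w; rewrite normrM; apply: ler_pM => //; exact: gC.
set C := K + `|mK| in gC ig *.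
pose S1 n w := n%:R^-1 * \sum_(t < n) r (u t w).
(* The square is built in, so that Chebyshev's inequality is Markov's inequality for [S2] at level
   [(k / 3) ^+ 2]. *)
pose S2 n w := (n%:R^-1 * \sum_(t < n) g (u t w)) ^+ 2.
have isum1 n : P.-integrable setT (EFin \o S1 n).
  by apply: integrableZR; apply: integrable_sumR => t; case: (ir t).
have igg s t : P.-integrable setT (EFin \o (fun w => g (u s w) * g (u t w))).
  apply: (@le_bounded_integrable _ _ _ _ _ (C * C)).
    by apply: measurable_funM; exact: measurableT_comp.
  by move=> w; rewrite normrM; apply: ler_pM => //; exact: gC.
have isq n : P.-integrable setT (EFin \o (fun w => (\sum_(t < n) g (u t w)) ^+ 2)).
  under eq_fun do rewrite expr2 big_distrlr /=.
  by apply: integrable_sumR => s; exact: integrable_sumR.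
have isum2 n : P.-integrable setT (EFin \o S2 n).
  by rewrite /S2; under eq_fun do rewrite exprMn; exact: integrableZR.
near=> n.
have n0 : (0 < n)%N by near: n; exact: nbhs_infty_gt.
have nR0 : 0 < n%:R :> R by rewrite ltr0n.
have k3 : 0 < k / 3 by rewrite divr_gt0.
have k9 : 0 < (k / 3) ^+ 2 by rewrite exprn_gt0.
exists ([set w | k / 3 <= `|S1 n w|] `|` [set w | (k / 3) ^+ 2 <= `|S2 n w|]).
  have m1 := measurable_ge_norm (k / 3) (measurable_fun_integrableR (isum1 n)).
  have m2 := measurable_ge_norm ((k / 3) ^+ 2)
    (measurable_fun_integrableR (isum2 n)).
  split; first exact: measurableU.
  rewrite (le_trans (measureU2 _ m1 m2))// [X in X%:E](splitr eta) EFinD.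
  apply: leeD.
    apply: le_trans (markov_Rintegral k3 (isum1 n)) _; rewrite lee_fin.
    have h : \int[P]_w `|S1 n w| <= e.
      have iS : P.-integrable setT
          (EFin \o (fun w => \sum_(t < n) `|r (u t w)|)).
        exact: integrable_sumR.
      have : \int[P]_w `|S1 n w| <=
          \int[P]_w (n%:R^-1 * \sum_(t < n) `|r (u t w)|).
        apply: le_Rintegral => //; first exact: integrable_normR.
          exact: integrableZR.
        move=> w _; rewrite normrM ger0_norm ?invr_ge0//.
        by rewrite ler_wpM2l ?invr_ge0// ler_norm_sum.
      move=> /le_trans; apply; rewrite RintegralZl// Rintegral_sum//.
      rewrite ler_pdivrMl// mulr_natl -[X in _ *+ X](card_ord n) -sumr_const.
      exact: ler_sum.
    rewrite ler_pdivrMl//; apply: le_trans h _.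
    rewrite /e ge_min; apply/orP; left.
    by rewrite le_eqVlt; apply/orP; left; apply/eqP; field.
  apply: le_trans (markov_Rintegral k9 (isum2 n)) _; rewrite lee_fin.
  have h : \int[P]_w `|S2 n w| <= n%:R^-1 * C ^+ 2.
    under eq_Rintegral do rewrite ger0_norm ?sqr_ge0//.
    rewrite /S2; under eq_Rintegral do rewrite exprMn.
    rewrite RintegralZl// expr2 -mulrA ler_wpM2l ?invr_ge0//.
    rewrite ler_pdivrMl//.
    apply: (@Rintegral_sqr_sum_le (fun t => g \o u t)) => // [t|t w].
      exact: measurableT_comp.
    exact: gC.
  rewrite ler_pdivrMl//; apply: le_trans h _.
  (* The mean of [S2] is at most [C ^+ 2 / n], which falls below this quantity once [n] is large. *)
  have q0 : 0 < (k / 3) ^+ 2 * (eta / 2) by rewrite mulr_gt0// divr_gt0.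
  rewrite ler_pdivrMl// -ler_pdivrMr//; near: n.
  exact: nbhs_infty_ger.
move=> w /not_orP[/= /negP + /negP]; rewrite -!ltNge => h1 h2.
have {}h2 : `|n%:R^-1 * \sum_(t < n) g (u t w)| < k / 3.
  by move: h2; rewrite /S2 normrX ltr_pXn2r// nnegrE ltW.
have -> : n%:R^-1 * (\sum_(t < n) u t w) - m =
    S1 n w + n%:R^-1 * \sum_(t < n) g (u t w) + (mK - m).
  rewrite /S1 /r /g !sumrB sumr_const card_ord -(mulr_natl mK).
  by field; rewrite pnatr_eq0 -lt0n.
rewrite (le_lt_trans (ler_normD _ _))//.
have : `|S1 n w + n%:R^-1 * \sum_(t < n) g (u t w)| < k / 3 + k / 3.
  by rewrite (le_lt_trans (ler_normD _ _))// ltrD.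
have : e <= k / 3 by rewrite /e ge_min lexx orbT.
by move: mKm => h3 h4 h5; lra.
Unshelve. all: by end_near. Qed.

End WeakLawOfLargeNumbers.

(** * Positive semidefinite matrices and growth of the determinant *)

Section PositiveSemidefinite.
Context {R : realFieldType}.
Implicit Types n : nat.

(** The matrix determinant lemma: the bordered matrix [M] factors in two ways, by eliminating either
    diagonal block, and each side is its determinant. *)
Lemma det_add_mul_rV n (A : 'M[R]_n) (u : 'cV[R]_n) (v : 'rV[R]_n) :
  A \in unitmx ->
  \det (A + u *m v) = \det A * (1 + (v *m invmx A *m u) ord0 ord0).
Proof.
move=> uA.
pose M : 'M[R]_(n + 1) := block_mx A (- u) v 1%:M.
have M1 : M = block_mx 1%:M (- u) 0 1%:M *m block_mx (A + u *m v) 0 v 1%:M.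
  rewrite mulmx_block !mul1mx !mulmx1 !mul0mx ?mulmx0 !add0r.
  by rewrite mulNmx addrK.
have M2 : M = block_mx A 0 v (1%:M + v *m invmx A *m u)
              *m block_mx 1%:M (- (invmx A *m u)) 0 1%:M.
  rewrite mulmx_block !mulmx1 !mulmx0 !addr0 !mulmxN !mulmxA mulmxV//.
  by rewrite mul1mx addrC addrK.
transitivity (\det M).
  by rewrite M1 det_mulmx det_ublock det_lblock !det1 !mul1r mulr1.
rewrite M2 det_mulmx det_ublock det_lblock !det1 !mulr1 det_mx11 mxE mxE.
by rewrite eqxx.
Qed.

Definition qform n (A : 'M[R]_n) (x y : 'rV[R]_n) : R :=
  (x *m A *m y^T) ord0 ord0.

(** Symmetry has to be demanded: the values of [qform A x x] do not see the antisymmetric part of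
    [A]. *)
Definition psdmx n (A : 'M[R]_n) : Prop :=
  A^T = A /\ forall x, 0 <= qform A x x.

Lemma qformDl n (A : 'M[R]_n) x y z :
  qform A (x + y) z = qform A x z + qform A y z.
Proof. by rewrite /qform !mulmxDl mxE. Qed.

Lemma qformZl n (A : 'M[R]_n) c x z : qform A (c *: x) z = c * qform A x z.
Proof. by rewrite /qform -!scalemxAl mxE. Qed.

Lemma qformC n (A : 'M[R]_n) x y : A^T = A -> qform A x y = qform A y x.
Proof.
move=> sA; rewrite /qform -[in LHS](trmxK (x *m A *m y^T)) [LHS]mxE.
by rewrite !trmx_mul trmxK sA mulmxA.
Qed.

Lemma qform_mxD n (A B : 'M[R]_n) x y :
  qform (A + B) x y = qform A x y + qform B x y.
Proof. by rewrite /qform mulmxDr mulmxDl mxE. Qed.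

Lemma qform_sqrD n (A : 'M[R]_n) x y t : A^T = A ->
  qform A (x + t *: y) (x + t *: y) =
  qform A x x + 2 * t * qform A x y + t ^+ 2 * qform A y y.
Proof.
move=> sA; rewrite qformDl qformZl !(qformC _ (x + t *: y) sA) !qformDl.
by rewrite !qformZl (qformC y x sA); ring.
Qed.

Lemma psdmx_CauchySchwarz n (A : 'M[R]_n) x y : psdmx A ->
  qform A x y ^+ 2 <= qform A x x * qform A y y.
Proof.
move=> [sA pA]; have := pA x; rewrite le_eqVlt => /predU1P[x0|x0].
  rewrite -x0 mul0r; have [->|b0] := eqVneq (qform A x y) 0.
    by rewrite expr0n.
  (* When [qform A x x] vanishes, the form along [y + t x] is affine in [t]; with a nonzero slope,
     this [t] makes it equal to -1. *)
  have := pA (y + (- (qform A y y + 1) / (2 * qform A x y)) *: x).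
  rewrite qform_sqrD// -x0 mulr0 addr0 (qformC y x sA).
  set b := qform A x y in b0 *; set c := qform A y y.
  have -> : c + 2 * (- (c + 1) / (2 * b)) * b = -1 by field.
  by rewrite oppr_ge0 ler10.
(* This coefficient minimizes the quadratic polynomial in [t], whose minimum is the Cauchy-Schwarz
   defect divided by [qform A x x]. *)
have := pA (y + (- qform A x y / qform A x x) *: x).
rewrite qform_sqrD// (qformC y x sA).
set b := qform A x y; set c := qform A y y; set a := qform A x x in x0 *.
have -> : c + 2 * (- b / a) * b + (- b / a) ^+ 2 * a = (a * c - b ^+ 2) / a.
  by field; rewrite gt_eqF.
by rewrite pmulr_lge0 ?invr_gt0// subr_ge0.
Qed.

(** Cauchy-Schwarz against each basis vector forces the corresponding coordinate of [x *m A] to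
    vanish. *)
Lemma psdmx_qform_eq0 n (A : 'M[R]_n) x : psdmx A ->
  qform A x x = 0 -> x *m A = 0.
Proof.
move=> pA x0; apply/rowP => j; rewrite !mxE.
have := psdmx_CauchySchwarz x (delta_mx ord0 j) pA.
rewrite x0 mul0r; have -> : qform A x (delta_mx ord0 j) = (x *m A) ord0 j.
  by rewrite /qform trmx_delta -colE mxE.
move=> h; have /eqP : (x *m A) ord0 j ^+ 2 = 0.
  by apply/eqP; rewrite eq_le h sqr_ge0.
by rewrite sqrf_eq0 mxE => /eqP.
Qed.

Lemma psdmx_neq0 n (A : 'M[R]_n) : psdmx A -> A != 0 ->
  exists x, 0 < qform A x x.
Proof.
move=> pA; move=> A0; apply: contrapT => /forallNP h; move: A0.
have xA (x : 'rV_n) : x *m A = 0.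
  apply: psdmx_qform_eq0 => //; apply/eqP; rewrite eq_le pA.2 andbT leNgt.
  exact/negP/h.
apply/negP; rewrite negbK; apply/eqP/row_matrixP => i.
by rewrite row0 rowE xA.
Qed.

Lemma psdmxD n (A B : 'M[R]_n) : psdmx A -> psdmx B -> psdmx (A + B).
Proof.
move=> [sA pA] [sB pB]; split; first by rewrite linearD /= sA sB.
by move=> x; rewrite qform_mxD addr_ge0.
Qed.

Lemma qform_rank1 n (v x y : 'rV[R]_n) :
  qform (v^T *m v) x y = (x *m v^T) ord0 ord0 * (y *m v^T) ord0 ord0.
Proof.
rewrite /qform mulmxA -mulmxA mxE big_ord_recl big_ord0 addr0.
congr (_ * _); rewrite -[v *m y^T]trmxK [LHS]mxE trmx_mul trmxK.
by [].
Qed.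

Lemma psdmx_rank1 n (v : 'rV[R]_n) : psdmx (v^T *m v).
Proof.
split; first by rewrite trmx_mul trmxK.
by move=> x; rewrite qform_rank1 -expr2 sqr_ge0.
Qed.

Lemma psdmxZ n (c : R) (A : 'M[R]_n) : 0 <= c -> psdmx A -> psdmx (c *: A).
Proof.
move=> c0 [sA pA]; split; first by rewrite linearZ /= sA.
move=> x; rewrite /qform -scalemxAr -scalemxAl mxE mulr_ge0//.
exact: pA.
Qed.

(** One step of Lagrange reduction. Nonnegativity of the form of [Q'] is exactly Cauchy-Schwarz for
    [Q]; the rank drops because [x] is killed by [Q'] but not by [Q]. *)
Lemma psdmx_peel n (Q : 'M[R]_n) (x : 'rV[R]_n) :
  psdmx Q -> 0 < qform Q x x ->
  let v := x *m Q in
  let Q' := Q - (qform Q x x)^-1 *: (v^T *m v) in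
  psdmx Q' /\ (\rank Q' < \rank Q)%N.
Proof.
move=> pQ; have [sQ _] := pQ; set c := qform Q x x => c0 v Q'.
have vE y : (y *m v^T) ord0 ord0 = qform Q y x.
  by rewrite /v trmx_mul sQ mulmxA.
have sQ' : Q'^T = Q' by rewrite /Q' linearB linearZ /= trmx_mul trmxK sQ.
have xQ' : x *m Q' = 0.
  rewrite /Q' mulmxBr -scalemxAr mulmxA [x *m v^T]mx11_scalar vE -/c.
  by rewrite mul_scalar_mx scalerA mulVf ?gt_eqF// scale1r subrr.
split.
  split=> // y; rewrite /Q' qform_mxD -scaleNr.
  have -> a : qform (a *: (v^T *m v)) y y = a * qform (v^T *m v) y y.
    by rewrite /qform -scalemxAr -scalemxAl mxE.
  rewrite qform_rank1 vE mulNr subr_ge0 mulrC ler_pdivrMr// -expr2 mulrC.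
  by rewrite qformC//; apply: psdmx_CauchySchwarz.
have Q'Q : (Q' <= Q)%MS.
  have -> : Q' = (1%:M - c^-1 *: (v^T *m x)) *m Q.
    by rewrite mulmxBl mul1mx -scalemxAl -mulmxA.
  exact: submxMl.
rewrite ltn_neqAle mxrankS// andbT; apply/negP => /eqP rk.
(* Equal ranks would make the row spaces equal, so [Q = D *m Q']; by symmetry [x *m Q] would factor
   through [x *m Q' = 0]. *)
have /submxP[D QD] : (Q <= Q')%MS.
  by have := mxrank_leqif_sup Q'Q; case=> _; rewrite rk eqxx => <-.
have : x *m Q = 0 by rewrite -sQ QD trmx_mul sQ' mulmxA xQ' mul0mx.
by move=> xQ; move: c0; rewrite /c /qform xQ mul0mx mxE ltxx.
Qed.

Lemma psdmx_unit_qform_gt0 n (A : 'M[R]_n) x : psdmx A -> A \in unitmx ->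
  x != 0 -> 0 < qform A x x.
Proof.
move=> pA uA x0; rewrite lt_neqAle pA.2 andbT eq_sym; apply: contra x0.
by move=> /eqP /(psdmx_qform_eq0 pA) xA; rewrite -(mulmxK uA x) xA mul0mx.
Qed.

(** By the matrix determinant lemma the determinant is multiplied by 1 plus [c] times the form of
    [invmx A] at [v], which is the form of [A] at [v *m invmx A], hence positive. *)
Lemma psdmx_det_ltD_rank1 n (A : 'M[R]_n) (v : 'rV[R]_n) (c : R) : psdmx A ->
  0 < \det A -> v != 0 -> 0 < c -> \det A < \det (A + c *: (v^T *m v)).
Proof.
move=> pA dA v0 c0; have uA : A \in unitmx by rewrite unitmxE unitfE gt_eqF.
rewrite scalemxAl det_add_mul_rV// ltr_pMr// ltrDl.
rewrite -scalemxAr mxE mulr_gt0//.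
have y0 : v *m invmx A != 0.
  by apply: contra v0 => /eqP h; rewrite -(mulmxKV uA v) h mul0mx.
have := psdmx_unit_qform_gt0 pA uA y0.
by rewrite /qform (mulmxKV uA) trmx_mul trmx_inv pA.1 mulmxA.
Qed.

(* Q is exhausted by successive rank-one summands, each of which increases the
   determinant. *)
Lemma psdmx_det_ltD n (A Q : 'M[R]_n) : psdmx A -> 0 < \det A ->
  psdmx Q -> Q != 0 -> \det A < \det (A + Q).
Proof.
have [k] := ubnP (\rank Q); elim: k A Q => // k IH A Q rk pA dA pQ Q0.
have [x x0] := psdmx_neq0 pQ Q0.
have [] := psdmx_peel pQ x0.
set c := (qform Q x x)^-1; set v := x *m Q; set Q' := Q - _ => pQ' rk'.
have c0 : 0 < c by rewrite invr_gt0.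
have v0 : v != 0.
  by apply: contraTneq x0 => h; rewrite /qform -/v h mul0mx mxE ltxx.
have lt1 := psdmx_det_ltD_rank1 pA dA v0 c0.
have -> : A + Q = (A + c *: (v^T *m v)) + Q' by rewrite /Q' -addrA subrKC.
have [->|Q'0] := eqVneq Q' 0; first by rewrite addr0.
apply: (lt_trans lt1); apply: IH => //.
- by apply: leq_trans rk' _; rewrite -ltnS.
- by apply: psdmxD => //; apply: psdmxZ; [exact: ltW | exact: psdmx_rank1].
- exact: lt_trans dA lt1.
Qed.

Lemma psdmx_scalar n (c : R) : 0 <= c -> psdmx (c%:M : 'M[R]_n).
Proof.
move=> c0; split; first by rewrite tr_scalar_mx.
move=> x; rewrite /qform mul_mx_scalar -scalemxAl mxE mulr_ge0// mxE.
by apply: sumr_ge0 => i _; rewrite mxE -expr2 sqr_ge0.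
Qed.

Lemma psdmx_det_scalarD n (A : 'M[R]_n) (c : R) : psdmx A -> 0 < c ->
  0 < \det (c%:M + A).
Proof.
move=> pA c0; have d0 : 0 < \det (c%:M : 'M[R]_n).
  by rewrite det_scalar exprn_gt0.
have [->|A0] := eqVneq A 0; first by rewrite addr0.
by apply: (lt_trans d0); apply: psdmx_det_ltD => //; apply: psdmx_scalar; exact: ltW.
Qed.

End PositiveSemidefinite.

(** * Continuity of the determinant *)

Section DeterminantContinuity.
Context {R : realType}.

Lemma det_near n (A : 'M[R]_n) (e : R) : 0 < e ->
  exists2 delta : R, 0 < delta & forall B : 'M[R]_n,
    (forall i j, `|A i j - B i j| < delta) -> `|\det A - \det B| < e.
Proof.
move=> e0.
have cp (f : 'I_n -> 'I_n) :
    continuous (fun B : 'M[R]_n => \prod_(i < n) B i (f i)).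
  apply: continuous_big => /= [x|i _]; first exact: mul_continuous.
  exact: coord_continuous.
have c : continuous (fun B : 'M[R]_n => \det B).
  apply: continuous_big => /= [|s _].
    by move=> x; exact: add_continuous.
  by move=> B; exact: (cvgM (cvg_cst _) (cp _ B)).
have /cvgrPdist_lt/(_ e e0) := c A.
move=> /nbhs_ballP[delta delta0 h]; exists delta => // B AB.
by apply: h; split.
Qed.

(** [A] is a limit of the matrices [c%:M + A] with [c > 0], whose determinants are positive;
    continuity excludes a negative determinant and invertibility a zero one. *)
Lemma psdmx_unit_det_gt0 n (A : 'M[R]_n) : psdmx A -> A \in unitmx ->
  0 < \det A.
Proof.
move=> pA uA; rewrite lt_neqAle eq_sym -unitfE -unitmxE uA /=.
rewrite leNgt; apply/negP => dA.
have [delta delta0 h] := det_near A (e := - \det A) ltac:(by rewrite oppr_gt0).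
have d2 : 0 < delta / 2 by rewrite divr_gt0.
have : forall i j, `|A i j - ((delta / 2)%:M + A) i j| < delta.
  move=> i j; rewrite !mxE opprD addrCA subrr addr0 normrN.
  case: (i == j); last by rewrite mulr0n normr0.
  by rewrite mulr1n gtr0_norm//; lra.
move=> /h; rewrite distrC => /(le_lt_trans (ler_norm _)).
by have := psdmx_det_scalarD pA d2; lra.
Qed.

End DeterminantContinuity.

(** * Random vectors: from rectangles to the generated sigma-algebra *)

Definition rectangles (R : realType) (k : nat) : set (set 'cV[R]_k) :=
  [set A | exists2 B : 'I_k -> set R, (forall i, measurable (B i)) &
     A = [set x : 'cV[R]_k | forall i, B i (x i ord0)]].
Arguments rectangles : clear implicits.

Notation borel_cV R k := (g_sigma_algebraType (rectangles R k)).

Section RandomVectors.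
Context {R : realType}.

Lemma rectanglesI k : setI_closed (rectangles R k).
Proof.
move=> _ _ [A mA ->] [B mB ->]; exists (fun i => A i `&` B i).
  by move=> i; exact: measurableI.
apply/seteqP; split => [x [Ax Bx] i //|x AB].
by split=> i; have [] := AB i.
Qed.

Lemma rectanglesT k : rectangles R k setT.
Proof. by exists (fun=> setT) => //; apply/seteqP. Qed.

(** Rectangles form a pi-system that contains the whole space, so the constant sequence [setT]
    serves as the exhausting sequence. *)
Lemma eq_measure_rectangles k (m1 m2 : {measure set (borel_cV R k) -> \bar R}) :
  (m1 setT < +oo)%E -> (forall A, rectangles R k A -> m1 A = m2 A) ->
  forall A, measurable A -> m1 A = m2 A.
Proof.
move=> m1T m12 A mA.
apply: (@measure_unique _ R (borel_cV R k) (rectangles R k) (fun=> setT)) => //.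
- exact: rectanglesI.
- by move=> _; exact: rectanglesT.
- by apply/seteqP; split => // x _; exists 0%N.
Qed.

Lemma measurable_coord k (i : 'I_k) :
  measurable_fun setT (fun x : borel_cV R k => (x : 'cV[R]_k) i ord0).
Proof.
move=> _ A mA; rewrite setTI; apply: sub_sigma_algebra.
exists (fun j => if j == i then A else setT).
  by move=> j; case: ifP.
apply/seteqP; split=> x /=; last by move=> /(_ i); rewrite eqxx.
by move=> Ax j; case: eqP => // ->.
Qed.

Context {dT : measure_display} {T : measurableType dT}.
Variable P : probability T R.

Lemma rv_measurable_fun k (X : T -> 'cV[R]_k) : rv_measurable X ->
  measurable_fun setT (X : T -> borel_cV R k).
Proof.
move=> mX; apply: (@measurability _ _ _ (borel_cV R k) _ _ (rectangles R k)) => //.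
move=> _ [_ [B mB ->] <-]; rewrite setTI.
have -> : X @^-1` [set x : 'cV[R]_k | forall i, B i (x i ord0)] =
    \bigcap_(i in [set: 'I_k]) ((fun w => X w i ord0) @^-1` B i).
  by apply/seteqP; split=> [w h i _|w h i]; [exact: h | exact: (h i)].
apply: fin_bigcap_measurable => // i _.
by rewrite -[X in measurable X]setTI; exact: mX.
Qed.

Lemma identically_distributed_law k (X : nat -> T -> 'cV[R]_k) :
  (forall t, rv_measurable (X t)) -> identically_distributed P X ->
  forall t (A : set (borel_cV R k)), measurable A ->
    P (X t @^-1` A) = P (X 0%N @^-1` A).
Proof.
move=> mX idX t A mA.
pose fX s : {mfun T >-> borel_cV R k} := HB.pack (X s : T -> borel_cV R k)
  (isMeasurableFun.Build _ _ _ _ _ (rv_measurable_fun (mX s))).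
apply: (@eq_measure_rectangles k (distribution P (fX t))
  (distribution P (fX 0%N))) => //.
  by rewrite (le_lt_trans (probability_le1 _ _))// ltry.
by move=> _ [B mB ->]; exact: idX.
Qed.

(** For fixed [E], both sides are finite measures in [B]: the image under [X] of [P] restricted to
    [E], and the law of [X] scaled by [P E]. They agree on rectangles. *)
Lemma independent_event_extend k (E : set T) (X : T -> 'cV[R]_k) :
  measurable E -> rv_measurable X ->
  (forall B, rectangles R k B -> P (E `&` X @^-1` B) = (P E * P (X @^-1` B))%E) ->
  forall B : set (borel_cV R k), measurable B ->
    P (E `&` X @^-1` B) = (P E * P (X @^-1` B))%E.
Proof.
move=> mE mX EX B mB; have mXf := rv_measurable_fun mX.
pose fX : {mfun T >-> borel_cV R k} := HB.pack (X : T -> borel_cV R k)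
  (isMeasurableFun.Build _ _ _ _ _ mXf).
have fE : 0 <= fine (P E) by exact: fine_ge0.
have PE : ((NngNum fE)%:num)%:E = P E by rewrite /= fineK// fin_num_measure.
pose m1 : {measure set _ -> \bar R} := pushforward (mrestr P mE) fX.
pose m2 : {measure set _ -> \bar R} := mscale (NngNum fE) (distribution P fX).
have m1E A : m1 mXf A = P (E `&` X @^-1` A) by rewrite setIC.
have m2E A : m2 A = (P E * P (X @^-1` A))%E by rewrite -PE.
rewrite -(m1E B) -m2E.
apply: eq_measure_rectangles mB.
  rewrite m1E preimage_setT setIT.
  by rewrite (le_lt_trans (probability_le1 _ _))// ltry.
by move=> A rA; rewrite m1E m2E EX.
Qed.

(** The product rule is extended one variable at a time: a measurable event of one vector is frozen
    while the event of the other is reduced to a rectangle. *)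
Lemma independent2_events k l (X : T -> 'cV[R]_k) (Y : T -> 'cV[R]_l) :
  rv_measurable X -> rv_measurable Y -> independent2 P X Y ->
  independent_events_of P (X : T -> borel_cV R k) (Y : T -> borel_cV R l).
Proof.
move=> mX mY XY A B mA mB.
have mXA : measurable (X @^-1` A).
  by rewrite -[X in measurable X]setTI; exact: rv_measurable_fun.
apply: independent_event_extend => // _ [B' mB' ->].
have mYB : measurable (Y @^-1` [set x : 'cV[R]_l | forall i, B' i (x i ord0)]).
  rewrite -[X in measurable X]setTI; apply: rv_measurable_fun => //.
  by apply: sub_sigma_algebra; exists B'.
rewrite setIC muleC; apply: independent_event_extend => // _ [A' mA' ->].
by rewrite setIC muleC; exact: XY.
Qed.

Lemma mutually_independent_pair k (X : nat -> T -> 'cV[R]_k) s t :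
  s != t -> mutually_independent P X -> independent2 P (X s) (X t).
Proof.
move=> st mi A B mA mB.
have := mi [:: s; t] (fun j => if j == s then A else B).
have ts : (t == s) = false by rewrite eq_sym (negbTE st).
rewrite big_cons big_seq1 eqxx ts => <-.
- congr (P _); apply/seteqP; split => [w [Aw Bw] j|w h].
    rewrite !inE => /orP[] /eqP ->; first by rewrite eqxx.
    by rewrite ts.
  split; first by have := h s; rewrite eqxx; apply; rewrite inE eqxx.
  by have := h t; rewrite ts; apply; rewrite !inE eqxx orbT.
- by rewrite /= inE st.
- by move=> j i; case: ifP.
Qed.

Lemma iid_weak_law k (X : nat -> T -> 'cV[R]_k) (f : borel_cV R k -> R) (c : R) :
  iid P X -> measurable_fun setT f ->
  P.-integrable setT (EFin \o (fun w => f (X 0%N w))) -> 0 < c ->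
  whp P (fun n w =>
    `|n%:R^-1 * \sum_(t < n) f (X t w) - \int[P]_w f (X 0%N w)| < c).
Proof.
move=> [mX [miX idX]] mf ifX c0.
have mfX t : measurable_fun setT (fun w => f (X t w)).
  by apply: measurableT_comp mf _; exact: rv_measurable_fun.
apply: (weak_law_of_large_numbers mfX) => //.
- move=> s t st.
  apply: (@independent_events_of_comp _ _ _ _ _ _ _ _ (borel_cV R k) (borel_cV R k)
    R R (X s) (X t) f f) => //.
  apply: independent2_events => //.
  exact: mutually_independent_pair.
- move=> t A mA.
  apply: (identically_distributed_law mX idX t (A := f @^-1` A)).
  by rewrite -[X in measurable X]setTI; exact: mf.
Qed.

End RandomVectors.

(** * The perceptron: boundedness and measurability in the input *)

Section Perceptron.
Context {R : realType} {d' H d : nat}.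
Implicit Types (phi : R -> R) (W : mlp_param R d' H d) (z : 'cV[R]_d').

Definition preactivation W z (h : 'I_H) : R :=
  \sum_(j < d') W.1.1 h j * z j ord0 + W.1.2 h ord0.

Lemma mlpE phi W z i : mlp phi W z i ord0 =
  \sum_(h < H) W.2.1 i h * phi (preactivation W z h) + W.2.2 i ord0.
Proof.
rewrite /mlp !mxE; congr (_ + _); apply: eq_bigr => h _.
by rewrite !mxE.
Qed.

Lemma ler_abs_mx m n (M : 'M[R]_(m, n)) i j : `|M i j| <= `|M|.
Proof.
rewrite [leRHS](_ : _ = mx_norm M)// mx_normrE.
by apply/bigmax_geP; right => /=; exists (i, j).
Qed.

Lemma sigmoidal_measurable phi : sigmoidal phi -> measurable_fun setT phi.
Proof. by move=> [cphi _]; exact: continuous_measurable_fun. Qed.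

(** A monotone function lies between its limits at the two infinities. *)
Lemma sigmoidal_bounded phi : sigmoidal phi ->
  exists2 M : R, 0 <= M & forall x, `|phi x| <= M.
Proof.
move=> [_ [ndphi [lm [lp [_ [phim phip]]]]]].
have le_lp x : phi x <= lp.
  apply: (cvgr_to_ge phip); near=> y; apply: ndphi; near: y.
  by apply: nbhs_pinfty_ge; exact: num_real.
have ge_lm x : lm <= phi x.
  apply: (cvgr_to_le phim); near=> y; apply: ndphi; near: y.
  by apply: nbhs_ninfty_le; exact: num_real.
exists (`|lm| + `|lp|); first by rewrite addr_ge0.
move=> x; rewrite ler_norml; apply/andP; split.
  rewrite lerNl; have := ge_lm x; have := ler_norm (- lm); rewrite normrN.
  by have := normr_ge0 lp; lra.
by have := le_lp x; have := ler_norm lp; have := normr_ge0 lm; lra.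
Unshelve. all: by end_near. Qed.

(** The bound is uniform in the input, which makes the network outputs integrable whatever the law
    of the inputs. *)
Lemma mlp_bounded phi W i : sigmoidal phi ->
  exists2 C : R, 0 <= C & forall z, `|mlp phi W z i ord0| <= C.
Proof.
move=> /sigmoidal_bounded[M M0 phiM].
exists (\sum_(h < H) `|W.2.1 i h| * M + `|W.2.2 i ord0|).
  by rewrite addr_ge0// sumr_ge0// => h _; rewrite mulr_ge0.
move=> z; rewrite mlpE (le_trans (ler_normD _ _))// lerD2r.
rewrite (le_trans (ler_norm_sum _ _ _))// ler_sum// => h _.
by rewrite normrM ler_wpM2l.
Qed.

Section Measurability.
Context {dU : measure_display} {U : measurableType dU}.
Variable f : U -> 'cV[R]_d'.
Hypothesis mf : forall j, measurable_fun setT (fun x => f x j ord0).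

Lemma measurable_preactivation W h :
  measurable_fun setT (fun x => preactivation W (f x) h).
Proof.
apply: measurable_funD => //; apply: measurable_sum => j.
exact: measurable_funM.
Qed.

Lemma measurable_mlp phi W i : sigmoidal phi ->
  measurable_fun setT (fun x => mlp phi W (f x) i ord0).
Proof.
move=> /sigmoidal_measurable mphi; under eq_fun do rewrite mlpE.
apply: measurable_funD => //; apply: measurable_sum => h.
apply: measurable_funM => //.
by apply: measurableT_comp => //; exact: measurable_preactivation.
Qed.

End Measurability.
End Perceptron.

(** * Variation of the perceptron over a ball of weights *)

Section Oscillation.
Context {R : realType} {d' H d : nat}.
Implicit Types (phi : R -> R) (W : mlp_param R d' H d) (z : 'cV[R]_d').

Lemma mlp_param_entry_le W :
  [/\ forall i j, `|W.1.1 i j| <= `|W|, forall i, `|W.1.2 i ord0| <= `|W|,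
      forall i j, `|W.2.1 i j| <= `|W| & forall i, `|W.2.2 i ord0| <= `|W|].
Proof.
have n1 : `|W.1| <= `|W| by rewrite [leRHS]prod_normE le_max lexx.
have n2 : `|W.2| <= `|W| by rewrite [leRHS]prod_normE le_max lexx orbT.
split=> i.
- move=> j; apply: le_trans n1; apply: le_trans (ler_abs_mx W.1.1 i j) _.
  by rewrite [leRHS]prod_normE le_max lexx.
- apply: le_trans n1; apply: le_trans (ler_abs_mx W.1.2 i ord0) _.
  by rewrite [leRHS]prod_normE le_max lexx orbT.
- move=> j; apply: le_trans n2; apply: le_trans (ler_abs_mx W.2.1 i j) _.
  by rewrite [leRHS]prod_normE le_max lexx.
- apply: le_trans n2; apply: le_trans (ler_abs_mx W.2.2 i ord0) _.
  by rewrite [leRHS]prod_normE le_max lexx orbT.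
Qed.

(** The l1 norm of the input augmented by a constant coordinate 1, which accounts for the hidden
    bias; it bounds how far a preactivation moves when the weights move by [delta]. *)
Definition spread (delta : R) z : R := delta * (1 + \sum_(j < d') `|z j ord0|).

(* Since [phi] is monotone, its variation over an interval is its increment
   between the endpoints: this majorant, uniform over a ball of weights, is
   measurable in [z]. *)
Definition mlp_osc phi (M : R) W (delta : R) z (i : 'I_d) : R :=
  delta * (H%:R * M + 1) + \sum_(h < H) `|W.2.1 i h| *
    (phi (preactivation W z h + spread delta z) -
     phi (preactivation W z h - spread delta z)).

Lemma spread_ge0 (delta : R) z : 0 <= delta -> 0 <= spread delta z.
Proof. by move=> d0; rewrite mulr_ge0// addr_ge0// sumr_ge0. Qed.

Lemma preactivation_dist W W' z h delta : `|W - W'| <= delta ->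
  `|preactivation W z h - preactivation W' z h| <= spread delta z.
Proof.
move=> WW'; have [h1 h2 _ _] := mlp_param_entry_le (W - W').
have -> : preactivation W z h - preactivation W' z h =
    \sum_(j < d') (W - W').1.1 h j * z j ord0 + (W - W').1.2 h ord0.
  rewrite /preactivation opprD addrACA -sumrB; congr (_ + _).
    by apply: eq_bigr => j _; rewrite !mxE mulrBl.
  by rewrite !mxE.
rewrite (le_trans (ler_normD _ _))// /spread mulrDr mulr1 addrC lerD//.
  exact: le_trans (h2 h) WW'.
rewrite (le_trans (ler_norm_sum _ _ _))// mulr_sumr ler_sum// => j _.
by rewrite normrM ler_wpM2r// (le_trans (h1 h j)).
Qed.

Lemma mlp_dist phi M W W' z i delta : {homo phi : x y / x <= y} ->
  (forall x, `|phi x| <= M) -> `|W - W'| <= delta ->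
  `|mlp phi W z i ord0 - mlp phi W' z i ord0| <= mlp_osc phi M W' delta z i.
Proof.
move=> ndphi phiM WW'; have [_ _ h3 h4] := mlp_param_entry_le (W - W').
have phi_dist h : `|phi (preactivation W z h) - phi (preactivation W' z h)| <=
    phi (preactivation W' z h + spread delta z) -
    phi (preactivation W' z h - spread delta z).
  have := preactivation_dist z h WW'; rewrite ler_distl => /andP[lo hi].
  have s0 : 0 <= spread delta z.
    by apply: spread_ge0; exact: le_trans WW'.
  have := ndphi _ _ lo; have := ndphi _ _ hi.
  have : phi (preactivation W' z h) <= phi (preactivation W' z h + spread delta z).
    by apply: ndphi; rewrite lerDl.
  have : phi (preactivation W' z h - spread delta z) <= phi (preactivation W' z h).
    by apply: ndphi; rewrite gerBl.
  by rewrite ler_norml; move=> *; apply/andP; split; lra.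
rewrite !mlpE.
set u := preactivation W z; set u' := preactivation W' z.
(* The output weights are changed first, at a cost bounded through [M], and then the preactivations.
   The second sum carries the weights of the center [W'], so the majorant does not depend on [W]. *)
have -> : \sum_(h < H) W.2.1 i h * phi (u h) + W.2.2 i ord0 -
    (\sum_(h < H) W'.2.1 i h * phi (u' h) + W'.2.2 i ord0) =
    (\sum_(h < H) (W - W').2.1 i h * phi (u h) + (W - W').2.2 i ord0) +
    \sum_(h < H) W'.2.1 i h * (phi (u h) - phi (u' h)).
  rewrite opprD addrACA -sumrB [RHS]addrAC -big_split /=; congr (_ + _).
    by apply: eq_bigr => h _; rewrite !mxE; ring.
  by rewrite !mxE.
rewrite (le_trans (ler_normD _ _))// /mlp_osc lerD//.
  rewrite (le_trans (ler_normD _ _))// mulrDr mulr1 lerD//; last first.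
    exact: le_trans (h4 i) WW'.
  rewrite (le_trans (ler_norm_sum _ _ _))//.
  rewrite mulrCA mulr_natl -[X in _ *+ X](card_ord H) -sumr_const ler_sum// => h _.
  by rewrite normrM ler_pM// (le_trans (h3 i h)).
rewrite (le_trans (ler_norm_sum _ _ _))// ler_sum// => h _.
by rewrite normrM ler_wpM2l.
Qed.

Lemma mlp_osc_ge0 phi M W delta z i : {homo phi : x y / x <= y} ->
  (forall x, `|phi x| <= M) -> 0 <= delta -> 0 <= mlp_osc phi M W delta z i.
Proof.
move=> ndphi phiM d0.
have M0 : 0 <= M by exact: le_trans (phiM 0).
rewrite addr_ge0 ?mulr_ge0 ?addr_ge0 ?mulr_ge0// sumr_ge0// => h _.
rewrite mulr_ge0// subr_ge0 ndphi// lerD2l.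
by have := spread_ge0 z d0; lra.
Qed.

Lemma mlp_osc_bounded phi M W i : (forall x, `|phi x| <= M) ->
  exists2 C : R, 0 <= C & forall delta z, 0 <= delta -> delta <= 1 ->
    mlp_osc phi M W delta z i <= C.
Proof.
move=> phiM; have M0 : 0 <= M by exact: le_trans (phiM 0).
exists ((H%:R * M + 1) + \sum_(h < H) `|W.2.1 i h| * (M + M)).
  rewrite addr_ge0 ?addr_ge0 ?mulr_ge0// sumr_ge0// => h _.
  by rewrite mulr_ge0// addr_ge0.
move=> delta z d0 d1; rewrite /mlp_osc lerD//.
  by rewrite ler_piMl// addr_ge0 ?mulr_ge0.
rewrite ler_sum// => h _; rewrite ler_wpM2l//.
by rewrite (le_trans (ler_norm _))// (le_trans (ler_normB _ _))// lerD.
Qed.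

(** The limit is taken at a fixed input, since [spread] may be unbounded in [z]. The radii form a
    sequence so that dominated convergence applies. *)
Lemma mlp_osc_cvg0 phi M W z i : continuous phi ->
  mlp_osc phi M W (n.+1%:R^-1) z i @[n --> \oo] --> 0.
Proof.
move=> cphi.
have c0 : (n.+1%:R^-1 : R) @[n --> \oo] --> 0 by exact: cvg_harmonic.
have s0 : spread n.+1%:R^-1 z @[n --> \oo] --> (0 : R).
  rewrite -(mul0r (1 + \sum_(j < d') `|z j ord0|)).
  by apply: cvgM => //; exact: cvg_cst.
(* The limit 0 is rewritten as the value of the majorant at radius 0, so that limits can be taken
   term by term. *)
rewrite (_ : nbhs (0 : R) = nbhs (0 * (H%:R * M + 1) + \sum_(h < H) `|W.2.1 i h| *
    (phi (preactivation W z h + 0) - phi (preactivation W z h - 0)))); last first.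
  rewrite mul0r add0r big1// => h _; by rewrite subr0 addr0 subrr mulr0.
apply: cvgD.
  by apply: cvgM => //; exact: cvg_cst.
apply: cvg_big => [|h _]; first by move=> x; exact: add_continuous.
apply: cvgM; first exact: cvg_cst.
apply: cvgB.
  apply: (@cvg_comp _ _ _ _ phi _ _ _ _ (cphi _)).
  by apply: cvgD => //; exact: cvg_cst.
apply: (@cvg_comp _ _ _ _ phi _ _ _ _ (cphi _)).
by apply: cvgB => //; exact: cvg_cst.
Qed.

Lemma measurable_mlp_osc {dU : measure_display} {U : measurableType dU}
    (f : U -> 'cV[R]_d') phi M W delta i : sigmoidal phi ->
  (forall j, measurable_fun setT (fun x => f x j ord0)) ->
  measurable_fun setT (fun x => mlp_osc phi M W delta (f x) i).
Proof.
move=> sphi mf; have mphi := sigmoidal_measurable sphi.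
have ms : measurable_fun setT (fun x => spread delta (f x)).
  apply: measurable_funM => //; apply: measurable_funD => //.
  by apply: measurable_sum => j; exact: measurableT_comp.
apply: measurable_funD => //; apply: measurable_sum => h.
apply: measurable_funM => //; apply: measurable_funB.
  apply: measurableT_comp => //; apply: measurable_funD => //.
  exact: measurable_preactivation.
apply: measurableT_comp => //; apply: measurable_funB => //.
exact: measurable_preactivation.
Qed.

End Oscillation.

(** * Second moment matrices and vanishing integrals *)

Section SecondMoments.
Context {R : realType} {dT : measure_display} {T : measurableType dT}.
Variable P : probability T R.

Lemma Rintegral_cvg0 (f : nat -> T -> R) (g : T -> R) :
  (forall n, measurable_fun setT (f n)) -> P.-integrable setT (EFin \o g) ->
  (forall n w, `|f n w| <= g w) -> (forall w, f n w @[n --> \oo] --> 0) ->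
  \int[P]_w f n w @[n --> \oo] --> 0.
Proof.
move=> mf ig fg f0.
have mfE n : measurable_fun setT (EFin \o f n) by exact/measurable_EFinP.
have m0 : measurable_fun [set: T] (fun=> 0%E : \bar R) by exact: measurable_cst.
have cvg : {ae P, forall w, [set: T] w ->
    (EFin \o f n) w @[n --> \oo] --> (0%E : \bar R)}.
  by apply: aeW => w _; apply: cvg_EFin (f0 w); exact: nearW.
have dom : {ae P, forall w n, [set: T] w ->
    (`|(EFin \o f n) w| <= (EFin \o g) w)%E}.
  by apply: aeW => w n _ /=; rewrite lee_fin.
have [_ _ h] := dominated_convergence measurableT mfE m0 cvg ig dom.
by move: h; rewrite integral0 => /fine_cvg.
Qed.

(** The quadratic form at [x] is the expectation of the square of the linear combination of the
    [f i] with coefficients [x]. *)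
Lemma psdmx_second_moment n (f : 'I_n -> T -> R) :
  (forall i j, P.-integrable setT (EFin \o (fun w => f i w * f j w))) ->
  psdmx (\matrix_(i, j) \int[P]_w (f i w * f j w)).
Proof.
move=> iff; split.
  by apply/matrixP => i j; rewrite !mxE; apply: eq_Rintegral => w _; rewrite mulrC.
move=> x.
have -> : qform (\matrix_(i, j) \int[P]_w (f i w * f j w)) x x =
    \int[P]_w (\sum_j \sum_i x ord0 i * x ord0 j * (f i w * f j w)).
  rewrite /qform mxE Rintegral_sum; last first.
    by move=> j; apply: integrable_sumR => i; exact: integrableZR.
  apply: eq_bigr => j _; rewrite !mxE mulr_suml Rintegral_sum; last first.
    by move=> i; exact: integrableZR.
  by apply: eq_bigr => i _; rewrite RintegralZl// !mxE; ring.
apply: Rintegral_ge0 => w _.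
rewrite (_ : \sum_j _ = (\sum_i x ord0 i * f i w) ^+ 2) ?sqr_ge0//.
rewrite expr2 big_distrlr /= exchange_big /=; apply: eq_bigr => i _.
by apply: eq_bigr => j _; ring.
Qed.

Lemma Rintegral_sqr_eq0 (f : T -> R) : measurable_fun setT f ->
  P.-integrable setT (EFin \o (fun w => f w * f w)) ->
  \int[P]_w (f w * f w) = 0 -> {ae P, forall w, f w = 0}.
Proof.
move=> mf iff f0.
have mff : measurable_fun setT (EFin \o (fun w => f w * f w)).
  by apply/measurable_EFinP; exact: measurable_funM.
have h : (\int[P]_w `|(f w * f w)%R%:E| = 0)%E.
  transitivity (\int[P]_w (f w * f w)%:E)%E.
    by apply: eq_integral => w _ /=; rewrite ger0_norm// -expr2 sqr_ge0.
  rewrite -(@fineK _ (\int[P]_w (f w * f w)%:E)%E); last exact: integrable_fin_num.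
  by rewrite -[X in X%:E]/(\int[P]_w (f w * f w)) f0.
have /(_ mff)[/(_ h)] := @ae_eq_integral_abs _ _ _ P setT measurableT
  (EFin \o (fun w => f w * f w)).
move=> + _; apply: filterS => w /(_ I) /= [] /eqP.
by rewrite -expr2 sqrf_eq0 => /eqP.
Qed.

End SecondMoments.

Lemma subr_mxE (V : zmodType) m n (A B : 'M[V]_(m, n)) i j :
  (A - B) i j = A i j - B i j.
Proof. by rewrite !mxE. Qed.

(** * The limiting contrast and its local uniform approximation *)

Section Consistency.
Context {R : realType} {dT : measure_display} {T : measurableType dT}.
Variable P : probability T R.
Context {d d' H : nat}.
Variables (phi : R -> R) (Y : nat -> T -> 'cV[R]_d) (Z : nat -> T -> 'cV[R]_d').
Implicit Types W : mlp_param R d' H d.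

Let X t w : borel_cV R (d + d') := col_mx (Y t w) (Z t w).

(** Written as a function of the stacked vector, the one assumed i.i.d., so that the weak law
    applies to any measurable expression in residuals. *)
Definition residual W (i : 'I_d) (x : 'cV[R]_(d + d')) : R :=
  usubmx x i ord0 - mlp phi W (dsubmx x) i ord0.

Lemma residualE W i t w :
  residual W i (X t w) = Y t w i ord0 - mlp phi W (Z t w) i ord0.
Proof. by rewrite /residual col_mxKu col_mxKd. Qed.

Lemma Gamma_nE n W w i j : Gamma_n phi Y Z n W w i j =
  n%:R^-1 * \sum_(t < n) residual W i (X t w) * residual W j (X t w).
Proof.
rewrite /Gamma_n mxE summxE; congr (_ * _); apply: eq_bigr => t _.
by rewrite !residualE mxE big_ord_recl big_ord0 addr0 !mxE.
Qed.

Definition Gamma W : 'M[R]_d :=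
  \matrix_(i, j) \int[P]_w (residual W i (X 0%N w) * residual W j (X 0%N w)).

Hypothesis sphi : sigmoidal phi.
Hypothesis iidX : iid P (fun t w => col_mx (Y t w) (Z t w)).

Lemma measurable_usubmx (i : 'I_d) :
  measurable_fun setT (fun x : borel_cV R (d + d') => usubmx x i ord0).
Proof.
by under eq_fun do rewrite mxE; exact: (measurable_coord (lshift d' i)).
Qed.

Lemma measurable_dsubmx (j : 'I_d') :
  measurable_fun setT (fun x : borel_cV R (d + d') => dsubmx x j ord0).
Proof.
by under eq_fun do rewrite mxE; exact: (measurable_coord (rshift d j)).
Qed.

Lemma measurable_residual W i :
  measurable_fun setT (residual W i : borel_cV R (d + d') -> R).
Proof.
apply: measurable_funB; first exact: measurable_usubmx.
by apply: measurable_mlp => // j; exact: measurable_dsubmx.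
Qed.

Lemma measurable_X t : measurable_fun setT (X t).
Proof.
by have [mX _] := iidX; exact: (rv_measurable_fun (X := X t) (mX t)).
Qed.

Lemma rv_measurable_Z t : rv_measurable (Z t).
Proof.
move=> j; have := measurableT_comp (measurable_dsubmx j) (measurable_X t).
by apply: eq_measurable_fun => w _ /=; rewrite col_mxKd.
Qed.

Lemma measurable_Y t i : measurable_fun setT (fun w => Y t w i ord0).
Proof.
have := measurableT_comp (measurable_usubmx i) (measurable_X t).
by apply: eq_measurable_fun => w _ /=; rewrite col_mxKu.
Qed.

Variable W0 : mlp_param R d' H d.

Let eps i w := Y 0%N w i ord0 - mlp phi W0 (Z 0%N w) i ord0.
Let Sigma := second_moment_mx P (fun w => Y 0%N w - mlp phi W0 (Z 0%N w)).
Let gap W (i : 'I_d) z := mlp phi W0 z i ord0 - mlp phi W z i ord0.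

Hypothesis indep : independent2 P (fun w => Y 0%N w - mlp phi W0 (Z 0%N w)) (Z 0%N).
Hypothesis centered : forall i,
  P.-integrable setT (fun w => (eps i w)%:E) /\ (\int[P]_w (eps i w)%:E = 0)%E.
Hypothesis unitSigma : Sigma \in unitmx.
Hypothesis eps_L2 : (\int[P]_w (\sum_(i < d) (eps i w) ^+ 2)%:E < +oo)%E.

Lemma measurable_eps i : measurable_fun setT (eps i).
Proof.
apply: measurable_funB; first exact: measurable_Y.
by apply: measurable_mlp => //; exact: rv_measurable_Z.
Qed.

Lemma integrable_eps_sqr :
  P.-integrable setT (EFin \o (fun w => \sum_(i < d) (eps i w) ^+ 2)).
Proof.
apply/integrableP; split.
  apply/measurable_EFinP; apply: measurable_sum => i.
  by apply: measurable_funX; exact: measurable_eps.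
apply: le_lt_trans eps_L2; rewrite le_eqVlt; apply/orP; left; apply/eqP.
apply: eq_integral => w _ /=; rewrite ger0_norm// sumr_ge0// => i _.
exact: sqr_ge0.
Qed.

Lemma integrable_epsM i j :
  P.-integrable setT (EFin \o (fun w => eps i w * eps j w)).
Proof.
have mij : measurable_fun setT (fun w => eps i w * eps j w).
  by apply: measurable_funM; exact: measurable_eps.
apply: (le_integrableR mij _ (integrableDR integrable_eps_sqr integrable_eps_sqr)).
have sqr_le k w : (eps k w) ^+ 2 <= \sum_(i < d) (eps i w) ^+ 2.
  by rewrite (bigD1 k)//= lerDl sumr_ge0// => l _; exact: sqr_ge0.
move=> w; have := sqr_le i w; have := sqr_le j w; rewrite normrM.
rewrite -(real_normK (num_real (eps i w))) -(real_normK (num_real (eps j w))).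
have := sqr_ge0 (`|eps i w| - `|eps j w|).
by set S := \sum_i0 _; nra.
Qed.

Lemma measurable_gap W i : measurable_fun setT (gap W i : borel_cV R d' -> R).
Proof.
apply: measurable_funB; apply: measurable_mlp => // j; exact: measurable_coord.
Qed.

Lemma measurable_gapZ W i : measurable_fun setT (fun w => gap W i (Z 0%N w)).
Proof.
exact: (measurableT_comp (measurable_gap W i)
  (rv_measurable_fun (rv_measurable_Z 0%N))).
Qed.

Lemma gap_bounded W i : exists2 C : R, 0 <= C & forall z, `|gap W i z| <= C.
Proof.
have [C0 C00 h0] := mlp_bounded W0 i sphi.
have [C1 C10 h1] := mlp_bounded W i sphi.
exists (C0 + C1); first by rewrite addr_ge0.
by move=> z; rewrite (le_trans (ler_normB _ _))// lerD.
Qed.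

Lemma integrable_gapM W i j : P.-integrable setT
  (EFin \o (fun w => gap W i (Z 0%N w) * gap W j (Z 0%N w))).
Proof.
have [C C0 hC] := gap_bounded W i; have [D D0 hD] := gap_bounded W j.
apply: (@le_bounded_integrable _ _ _ _ _ (C * D)).
  by apply: measurable_funM; exact: measurable_gapZ.
by move=> w; rewrite normrM ler_pM.
Qed.

Lemma integrable_gap W i :
  P.-integrable setT (EFin \o (fun w => gap W i (Z 0%N w))).
Proof.
have [C C0 hC] := gap_bounded W i.
by apply: (@le_bounded_integrable _ _ _ _ _ C) => //; exact: measurable_gapZ.
Qed.

Lemma integrable_eps_gap W i j :
  P.-integrable setT (EFin \o (fun w => eps i w * gap W j (Z 0%N w))).
Proof.
have [C C0 hC] := gap_bounded W j; have [ie _] := centered i.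
apply: (le_integrableR _ _ (integrableZR C (integrable_normR ie))).
  by apply: measurable_funM; [exact: measurable_eps | exact: measurable_gapZ].
by move=> w; rewrite normrM mulrC ler_wpM2r.
Qed.

(** The cross terms of the residual products: [gap] depends on the input alone, so independence
    factors the expectation and the centered noise contributes 0. *)
Lemma Rintegral_eps_gap W i j : \int[P]_w (eps i w * gap W j (Z 0%N w)) = 0.
Proof.
have [ie e0] := centered i.
rewrite (@Rintegral_independentM _ _ _ P (eps i) (fun w => gap W j (Z 0%N w))).
- by rewrite [\int[P]_w eps i w]/Rintegral e0 mul0r.
- exact: measurable_eps.
- exact: measurable_gapZ.
- have rv_eps : rv_measurable (fun w => Y 0%N w - mlp phi W0 (Z 0%N w)).
    by move=> k; under eq_fun do rewrite subr_mxE; exact: measurable_eps.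
  have := independent_events_of_comp (measurable_coord i) (measurable_gap W j)
    (independent2_events rv_eps (rv_measurable_Z 0%N) indep).
  by rewrite (_ : _ \o _ = eps i)//; apply/funext => w /=; rewrite subr_mxE.
- exact: ie.
- exact: integrable_gap.
- exact: integrable_eps_gap.
Qed.

Lemma residual_gap W i w : residual W i (X 0%N w) = eps i w + gap W i (Z 0%N w).
Proof. by rewrite residualE /eps /gap; ring. Qed.

Lemma residualME W i j w : residual W i (X 0%N w) * residual W j (X 0%N w) =
  eps i w * eps j w + eps i w * gap W j (Z 0%N w)
  + (eps j w * gap W i (Z 0%N w) + gap W i (Z 0%N w) * gap W j (Z 0%N w)).
Proof. by rewrite !residual_gap; ring. Qed.

Lemma integrable_residualM W i j : P.-integrable setT
  (EFin \o (fun w => residual W i (X 0%N w) * residual W j (X 0%N w))).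
Proof.
under eq_fun do rewrite residualME.
apply: integrableDR; apply: integrableDR.
- exact: integrable_epsM.
- exact: integrable_eps_gap.
- exact: integrable_eps_gap.
- exact: integrable_gapM.
Qed.

Lemma integrable_residual W i :
  P.-integrable setT (EFin \o (fun w => residual W i (X 0%N w))).
Proof.
under eq_fun do rewrite residual_gap.
apply: integrableDR; last exact: integrable_gap.
by have [] := centered i.
Qed.

Let gap_mx W : 'M[R]_d :=
  \matrix_(i, j) \int[P]_w (gap W i (Z 0%N w) * gap W j (Z 0%N w)).

Lemma GammaE W : Gamma W = Sigma + gap_mx W.
Proof.
apply/matrixP => i j; rewrite !mxE.
under eq_Rintegral do rewrite residualME.
have ige := integrable_eps_gap W; have igg := integrable_gapM W.
rewrite RintegralD//; last 2 first.
- by apply: integrableDR => //; exact: integrable_epsM.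
- exact: integrableDR.
rewrite !RintegralD//; last exact: integrable_epsM.
rewrite !Rintegral_eps_gap addr0 add0r; congr (_ + _).
by rewrite /Rintegral; congr fine; apply: eq_integral => w _; rewrite /eps !mxE.
Qed.

Lemma psdmx_Sigma : psdmx Sigma.
Proof.
have := psdmx_second_moment integrable_epsM; congr psdmx.
apply/matrixP => i j; rewrite !mxE /Rintegral; congr fine.
by apply: eq_integral => w _; rewrite /eps !mxE.
Qed.

Lemma det_Sigma_gt0 : 0 < \det Sigma.
Proof. exact: psdmx_unit_det_gt0 psdmx_Sigma unitSigma. Qed.

Lemma det_Gamma_gt W :
  ~ {ae P, forall w, mlp phi W (Z 0%N w) = mlp phi W0 (Z 0%N w)} ->
  \det Sigma < \det (Gamma W).
Proof.
move=> nW; rewrite GammaE; apply: psdmx_det_ltD.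
- exact: psdmx_Sigma.
- exact: det_Sigma_gt0.
- exact: psdmx_second_moment (integrable_gapM W).
(* If the perturbation vanished, its diagonal entries, the second moments of the gaps, would too;
   each gap would then be almost surely zero and the two networks would agree. *)
apply/eqP => Q0; apply: nW.
have h (i : 'I_d) : {ae P, forall w, gap W i (Z 0%N w) = 0}.
  apply: Rintegral_sqr_eq0; [exact: measurable_gapZ | exact: integrable_gapM |].
  by have /matrixP/(_ i i) := Q0; rewrite !mxE.
have : {ae P, forall w i, gap W i (Z 0%N w) = 0} by apply: filter_forall.
apply: filterS => w g0; apply/colP => i.
by apply/eqP; rewrite eq_sym -subr_eq0; apply/eqP; exact: g0.
Qed.

Lemma Gamma_W0 : Gamma W0 = Sigma.
Proof.
rewrite GammaE (_ : gap_mx W0 = 0) ?addr0//; apply/matrixP => i j.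
rewrite !mxE -[RHS](Rintegral_cst_probability P 0); apply: eq_Rintegral => w _.
by rewrite /gap subrr mul0r.
Qed.

Lemma Gamma_n_near W1 (k : R) : 0 < k -> exists2 delta : R, 0 < delta &
  whp P (fun n w => forall W, `|W - W1| <= delta ->
    forall i j, `|Gamma W1 i j - Gamma_n phi Y Z n W w i j| < k).
Proof.
move=> k0; have [M M0 phiM] := sigmoidal_bounded sphi.
have [cphi [ndphi _]] := sphi.
pose o delta i (x : borel_cV R (d + d')) := mlp_osc phi M W1 delta (dsubmx x) i.
(* Majorant of the change in a product of residuals, obtained by expanding around the center [W1]:
   two terms linear in the oscillations and one product of oscillations. *)
pose r delta i j (x : borel_cV R (d + d')) :=
  o delta i x * `|residual W1 j x| + o delta i x * o delta j x +
  `|residual W1 i x| * o delta j x.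
have o0 delta i x : 0 <= delta -> 0 <= o delta i x.
  by move=> d0; exact: mlp_osc_ge0.
have mo delta i : measurable_fun setT (o delta i).
  by apply: measurable_mlp_osc => // j; exact: measurable_dsubmx.
have mr delta i j : measurable_fun setT (r delta i j).
  have mn l : measurable_fun setT
      (fun x : borel_cV R (d + d') => `|residual W1 l x|).
    by apply: measurableT_comp => //; exact: measurable_residual.
  by apply: measurable_funD; [apply: measurable_funD|]; apply: measurable_funM.
have mrX delta i j : measurable_fun setT (fun w => r delta i j (X 0%N w)).
  exact: (measurableT_comp (mr delta i j) (measurable_X 0%N)).
have rP delta W i j x : `|W - W1| <= delta ->
    `|residual W i x * residual W j x - residual W1 i x * residual W1 j x|
    <= r delta i j x.
  move=> WW1.
  have res_dist l : `|residual W l x - residual W1 l x| <= o delta l x.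
    rewrite /residual opprB addrC addrA subrK distrC.
    exact: mlp_dist.
  rewrite (_ : _ - _ = (residual W i x - residual W1 i x) * residual W1 j x +
    (residual W i x - residual W1 i x) * (residual W j x - residual W1 j x) +
    residual W1 i x * (residual W j x - residual W1 j x)); last by ring.
  rewrite (le_trans (ler_normD _ _))// lerD//.
    rewrite (le_trans (ler_normD _ _))// lerD// normrM.
      by rewrite ler_wpM2r.
    by rewrite ler_pM.
  by rewrite normrM ler_wpM2l.
(* For radii at most 1 the oscillations are bounded by constants, so [r] is dominated by an affine
   function of the absolute residuals at the center. *)
have dom i j : exists2 g : T -> R, P.-integrable setT (EFin \o g) &
    forall n w, `|r n.+1%:R^-1 i j (X 0%N w)| <= g w.
  have [C C0 hC] := mlp_osc_bounded W1 i phiM.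
  have [D D0 hD] := mlp_osc_bounded W1 j phiM.
  exists (fun w => C * `|residual W1 j (X 0%N w)| + C * D +
    D * `|residual W1 i (X 0%N w)|).
    apply: integrableDR; [apply: integrableDR|].
    - by apply: integrableZR; apply: integrable_normR; exact: integrable_residual.
    - exact: integrable_cstR.
    - by apply: integrableZR; apply: integrable_normR; exact: integrable_residual.
  move=> n w; have i0 : 0 <= n.+1%:R^-1 :> R by rewrite invr_ge0.
  have i1 : n.+1%:R^-1 <= 1 :> R by rewrite invf_le1// ler1n.
  rewrite ger0_norm; last by rewrite !addr_ge0 ?mulr_ge0 ?o0.
  rewrite /r lerD ?lerD//.
  - by rewrite ler_wpM2r// hC.
  - by rewrite ler_pM ?o0// ?hC ?hD.
  - by rewrite mulrC ler_wpM2r// hD.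
have Er i j : \int[P]_w r n.+1%:R^-1 i j (X 0%N w) @[n --> \oo] --> 0.
  have [g ig rg] := dom i j.
  apply: (Rintegral_cvg0 _ ig rg) => // w.
  have oc l : o n.+1%:R^-1 l (X 0%N w) @[n --> \oo] --> 0.
    exact: mlp_osc_cvg0.
  rewrite (_ : nbhs (0 : R) = nbhs (0 * `|residual W1 j (X 0%N w)| + 0 * 0 +
    `|residual W1 i (X 0%N w)| * 0)); last by rewrite !mul0r mulr0 !addr0.
  apply: cvgD; [apply: cvgD|]; apply: cvgM => //; exact: cvg_cst.
(* The error budget: [k / 2] for the empirical moments at the center, [k / 4] for the mean of [r],
   and [k / 4] for the deviation of its empirical average from that mean. *)
have k4 : 0 < k / 4 by rewrite divr_gt0.
have k2 : 0 < k / 2 by rewrite divr_gt0.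
have [N EN] : exists N, forall i j,
    `|0 - \int[P]_w r N.+1%:R^-1 i j (X 0%N w)| < k / 4.
  have : \forall N \near \oo, forall i j,
      `|0 - \int[P]_w r N.+1%:R^-1 i j (X 0%N w)| < k / 4.
    apply: filter_forall => i; apply: filter_forall => j.
    by have /cvgrPdist_lt := Er i j; exact.
  exact: filter_ex.
set delta : R := N.+1%:R^-1 in EN.
have d0 : 0 < delta by rewrite invr_gt0.
exists delta => //.
have ir i j : P.-integrable setT (EFin \o (fun w => r delta i j (X 0%N w))).
  have [g ig rg] := dom i j.
  by apply: le_integrableR ig => // w; exact: rg.
have lln1 i j := iid_weak_law iidX
  (measurable_funM (measurable_residual W1 i) (measurable_residual W1 j))
  (integrable_residualM W1 i j) k2.
have lln2 i j := iid_weak_law iidX (mr delta i j) (ir i j) k4.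
have := whp_all (fun i => whp_all (fun j => whp_and (lln1 i j) (lln2 i j))).
apply: whp_mono => n w n0 h W WW1 i j; have [h1 h2] := h i j.
rewrite Gamma_nE mxE.
have n0R : 0 <= n%:R^-1 :> R by rewrite invr_ge0.
have h3 : `|n%:R^-1 * (\sum_(t < n) residual W i (X t w) * residual W j (X t w)) -
    n%:R^-1 * (\sum_(t < n) residual W1 i (X t w) * residual W1 j (X t w))| <=
    n%:R^-1 * \sum_(t < n) r delta i j (X t w).
  rewrite -mulrBr normrM ger0_norm// ler_wpM2l// -sumrB.
  by rewrite (le_trans (ler_norm_sum _ _ _))// ler_sum// => t _; exact: rP.
have := EN i j; rewrite sub0r normrN => /(le_lt_trans (ler_norm _)) h4.
move: h1 h2 h3; rewrite /= !ltr_norml !ler_norml.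
move=> /andP[a1 a2] /andP[b1 b2] /andP[c1 c2].
by apply/andP; split; lra.
Qed.

Lemma det_Gamma_n_near W1 (c : R) : 0 < c -> exists2 delta : R, 0 < delta &
  whp P (fun n w => forall W, `|W - W1| <= delta ->
    `|\det (Gamma W1) - \det (Gamma_n phi Y Z n W w)| < c).
Proof.
move=> c0; have [k k0 hk] := det_near (Gamma W1) c0.
have [delta d0 h] := Gamma_n_near W1 k0; exists delta => //.
by apply: whp_mono h => n w _ h W /h; exact: hk.
Qed.

(** Positivity on the left rules out the convention -oo for [W], and then also for [W'], so that
    both values are genuine logarithms. *)
Lemma U_n_le_det n W W' w :
  (U_n phi Y Z n W w <= U_n phi Y Z n W' w)%E ->
  0 < \det (Gamma_n phi Y Z n W w) ->
  \det (Gamma_n phi Y Z n W w) <= \det (Gamma_n phi Y Z n W' w).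
Proof.
rewrite /U_n => + D0; rewrite D0; case: ifPn => D'0 //.
by rewrite lee_fin ler_ln.
Qed.

Lemma not_minimizer_near W1 :
  ~ {ae P, forall w, mlp phi W1 (Z 0%N w) = mlp phi W0 (Z 0%N w)} ->
  exists2 delta : R, 0 < delta & whp P (fun n w => forall W, `|W - W1| <= delta ->
    ~ (U_n phi Y Z n W w <= U_n phi Y Z n W0 w)%E).
Proof.
move=> /det_Gamma_gt gt; have S0 := det_Sigma_gt0.
(* Half the gap: the two empirical determinants then lie on opposite sides of the midpoint. The
   midpoint being positive, the one at [W] is positive as well. *)
have c0 : 0 < (\det (Gamma W1) - \det Sigma) / 2 by rewrite divr_gt0// subr_gt0.
have [delta d0 h1] := det_Gamma_n_near W1 c0.
have [delta' d'0 h2] := det_Gamma_n_near W0 c0.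
exists delta => //; apply: whp_mono (whp_and h1 h2) => n w _ [g1 g2] W WW1 U.
have := g1 W WW1; have := g2 W0; rewrite subrr normr0 => /(_ (ltW d'0)).
rewrite Gamma_W0 !ltr_norml => /andP[a1 a2] /andP[b1 b2].
have D0 : 0 < \det (Gamma_n phi Y Z n W w) by lra.
by have := U_n_le_det U D0; lra.
Qed.

End Consistency.

(** * From local to uniform statements, and measurability of distances *)

Section Compactness.
Context {R : realType} {dT : measure_display} {T : measurableType dT}.
Variable P : probability T R.

(* Otherwise the sets outside which [Q] holds w.h.p. on [K] form a proper
   filter, which clusters in [K]. *)
Lemma whp_compact (V : topologicalType) (K : set V)
    (Q : nat -> T -> V -> Prop) : compact K ->
  (forall x, K x -> exists2 U, nbhs x U &
     whp P (fun n w => forall y, U y -> Q n w y)) ->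
  whp P (fun n w => forall y, K y -> Q n w y).
Proof.
move=> cK loc; apply: contrapT => nK.
pose F : set_system V :=
  [set S | whp P (fun n w => forall y, K y -> ~ S y -> Q n w y)].
have FF : ProperFilter F.
  split.
    by move=> F0; apply: nK; apply: whp_mono F0 => n w _ h y Ky; exact: h.
  split.
  - by apply: whpT => n w y _ /(_ I).
  - move=> A B FA FB; apply: whp_mono (whp_and FA FB) => n w _ [hA hB] y Ky.
    by move=> /not_andP[nA|nB]; [exact: hA | exact: hB].
  - move=> A B AB FA; apply: whp_mono FA => n w _ h y Ky nB.
    by apply: h => // /AB.
have FK : F K by apply: whpT => n w y Ky /(_ Ky).
have [x [Kx clx]] := cK F FF FK.
have [U nU hU] := loc x Kx.
have FU : F (~` U).
  by apply: whp_mono hU => n w _ h y _ /contrapT; exact: h.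
by have [y []] := clx _ _ FU nU.
Qed.

Lemma nbhs_norm_le (V : pseudoMetricNormedZmodType R) (x : V) (e : R) :
  0 < e -> nbhs x [set y | `|y - x| <= e].
Proof.
move=> e0; apply: filterS (nbhsx_ballx x e e0) => y.
by rewrite -ball_normE /= distrC => /ltW.
Qed.

Lemma measurable_mx_norm m n (f : T -> 'M[R]_(m, n)) :
  (forall i j, measurable_fun setT (fun w => f w i j)) ->
  measurable_fun setT (fun w => `|f w|).
Proof.
move=> mf.
have h (s : seq ('I_m * 'I_n)) :
    measurable_fun setT (fun w => \big[Num.max/0]_(ij <- s) `|f w ij.1 ij.2|).
  elim: s => [|ij s IH].
    by under eq_fun do rewrite big_nil; exact: measurable_cst.
  under eq_fun do rewrite big_cons.
  by apply: measurable_maxr => //; exact: measurableT_comp.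
have := h (index_enum _); apply: eq_measurable_fun => w _.
by rewrite [RHS](_ : _ = mx_norm (f w))// mx_normrE.
Qed.

Lemma measurable_param_dist {d' H d : nat} (f : T -> mlp_param R d' H d)
    (V : mlp_param R d' H d) : param_measurable f ->
  measurable_fun setT (fun w => `|f w - V|).
Proof.
move=> [m1 [m2 [m3 m4]]].
have mB m n (g : T -> 'M[R]_(m, n)) (A : 'M[R]_(m, n)) :
    (forall i j, measurable_fun setT (fun w => g w i j)) ->
    measurable_fun setT (fun w => `|g w - A|).
  move=> mg; apply: measurable_mx_norm => i j.
  by under eq_fun do rewrite subr_mxE; exact: measurable_funB.
have : measurable_fun setT (fun w =>
    Num.max (Num.max `|(f w).1.1 - V.1.1| `|(f w).1.2 - V.1.2|)
            (Num.max `|(f w).2.1 - V.2.1| `|(f w).2.2 - V.2.2|)).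
  by apply: measurable_maxr; apply: measurable_maxr; exact: mB.
by apply: eq_measurable_fun => w _; rewrite !prod_normE.
Qed.

End Compactness.

Unset Implicit Arguments.
Set Strict Implicit.
Set Printing Implicit Defensive.

Theorem mainTheorem2 (R : realType) (dT : measure_display)
  (T : measurableType dT) (P : probability T R)
  (d d' H : nat) (phi : R -> R)
  (Y : nat -> T -> 'cV[R]_d) (Z : nat -> T -> 'cV[R]_d')
  (W0 : mlp_param R d' H d) (Theta : set (mlp_param R d' H d))
  (G : set (mlp_param R d' H d -> mlp_param R d' H d))
  (What : nat -> T -> mlp_param R d' H d) :
  (* sigmoidal activation *)
  sigmoidal phi ->
  (* (Y_t, Z_t) i.i.d. *)
  iid P (fun t w => col_mx (Y t w) (Z t w)) ->
  (* noise eps = Y - F_{W0}(Z): independent of the input, centered,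
     invertible covariance, and E ||eps||^2 < oo *)
  independent2 P (fun w => Y 0%N w - mlp phi W0 (Z 0%N w)) (Z 0%N) ->
  (forall i, P.-integrable setT
               (fun w => (Y 0%N w i ord0 - mlp phi W0 (Z 0%N w) i ord0)%:E)
          /\ (\int[P]_w (Y 0%N w i ord0 - mlp phi W0 (Z 0%N w) i ord0)%:E
              = 0)%E) ->
  second_moment_mx P (fun w => Y 0%N w - mlp phi W0 (Z 0%N w)) \in unitmx ->
  (\int[P]_w (\sum_(i < d)
        (Y 0%N w i ord0 - mlp phi W0 (Z 0%N w) i ord0) ^+ 2)%:E < +oo)%E ->
  (* compact parameter set containing the true weights *)
  compact Theta -> Theta W0 ->
  (* finite group of weight transformations leaving F_W invariant *)
  finite_set G -> G id ->
  (forall g h, G g -> G h -> G (g \o h)) ->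
  (forall g, G g -> exists h, G h /\ h \o g = id) ->
  (forall g W, G g -> mlp phi (g W) = mlp phi W) ->
  (* identifiability in the quotient space *)
  (forall W, Theta W ->
     {ae P, forall w, mlp phi W (Z 0%N w) = mlp phi W0 (Z 0%N w)} ->
     exists g, G g /\ W = g W0) ->
  (* the estimator: measurable, and a minimizer of U_n over Theta *)
  (forall n, param_measurable (What n)) ->
  (forall n w, Theta (What n w) /\
     forall W, Theta W -> (U_n phi Y Z n (What n w) w <= U_n phi Y Z n W w)%E) ->
  (* conclusion: What_n -> W0 in probability, in the quotient space *)
  forall e : R, 0 < e ->
    (fun n => P [set w | forall g, G g -> e < `|What n w - g W0| ])
      @ \oo --> 0%E.
Proof.
move=> sphi iidX indep centered unitS L2 cTheta ThetaW0 finG _ _ _ _ ident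
  mWhat minWhat e e0.
pose far W := forall g, G g -> e < `|W - g W0|.
(* Being a minimizer is weakened to doing at least as well as [W0], a condition on [W] alone that
   can be excluded locally. *)
pose Q n w W := ~ ((U_n phi Y Z n W w <= U_n phi Y Z n W0 w)%E /\ far W).
have h : whp P (fun n w => forall W, Theta W -> Q n w W).
  apply: whp_compact cTheta _ => W1 ThetaW1.
  have near_ball (delta : R) : 0 < delta ->
      nbhs W1 [set W | `|W - W1| <= delta].
    exact: nbhs_norm_le.
  have [ae|nae] := pselect
      {ae P, forall w, mlp phi W1 (Z 0%N w) = mlp phi W0 (Z 0%N w)}.
    (* Here [W1] lies on the orbit of [W0], and no point of its ball of radius [e] is far from the
       orbit. *)
    have [g [Gg W1E]] := ident _ ThetaW1 ae.
    exists [set W | `|W - W1| <= e]; first exact: near_ball.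
    apply: whpT => n w W /= WW1 [_ /(_ g Gg)].
    by rewrite -W1E ltNge WW1.
  have [delta d0 hd] := not_minimizer_near sphi iidX indep centered unitS L2 nae.
  exists [set W | `|W - W1| <= delta]; first exact: near_ball.
  by apply: whp_mono hd => n w _ hW W /hW nU [].
apply: whp_cvg0.
  move=> n.
  (* The event is an intersection over the group, measurable because the group is finite. *)
  rewrite (_ : [set w | _] =
      \bigcap_(g in G) [set w | e < `|What n w - g W0|]); last by [].
  apply: fin_bigcap_measurable => // g _.
  have := measurable_param_dist (g W0) (mWhat n) measurableT
    (measurable_itv `]e, +oo[).
  congr (measurable _); rewrite setTI.
  by apply/seteqP; split => w /=; rewrite in_itv/= andbT.
apply: whp_mono h => n w _ hQ farw; have [ThetaW minW] := minWhat n w.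
by apply: (hQ _ ThetaW); split => //; exact: minW.
Qed.
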